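(* Let $0<p\le1$ and $\rho<\rho^*(p)$. There exist constants $0<c_4<1$ and $c_5>0$ such that whenever $\alpha=m/n>c_4$ and $n$ is sufficiently large, with probability at least $1-e^{-c_5n}$ an $m\times n$ matrix $A$ with i.i.d. $\mathcal N(0,1)$ entries has the property: every $\mathbf x\in\mathbb R^n$ whose support $T$ satisfies $|T|\le\rho n$ is the unique solution of $\min\{\|\mathbf v\|_p^p: A\mathbf v=A\mathbf x\}$.
   Context: $\|\mathbf v\|_p^p=\sum_i|v_i|^p$; the support of $\mathbf x$ is $\{i:x_i\ne0\}$. Let $f(z)=\sqrt{2/\pi}\,e^{-z^2/2}$ for $z\ge0$; $z^*(p)>0$ satisfies $\int_0^{z^*}x^pf(x)\,dx=\int_{z^*}^\infty x^pf(x)\,dx$ and $\rho^*(p)=1-\operatorname{erf}(z^*(p)/\sqrt2)$. *)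

(* Defs.v *)
From HB Require Import structures.
From mathcomp Require Import all_boot all_order all_algebra.
From mathcomp Require Import all_classical all_reals all_analysis.
Set Implicit Arguments. Unset Strict Implicit. Unset Printing Implicit Defensive.
Import Order.TTheory GRing.Theory Num.Theory.
Import numFieldNormedType.Exports.
Local Open Scope classical_set_scope.
Local Open Scope ring_scope.

Section defs.
Variable R : realType.

Definition halfgauss (z : R) : R := Num.sqrt (2 / pi) * expR (- (z ^+ 2) / 2).

Definition is_zstar (p z : R) : Prop :=
  0 < z /\
  (\int[lebesgue_measure]_(x in `[0%R, z]) ((x `^ p) * halfgauss x)%:E =
   \int[lebesgue_measure]_(x in `[z, +oo[) ((x `^ p) * halfgauss x)%:E)%E.

(* erf y = 2/sqrt(pi) int_0^y e^{-t^2} dt  (y >= 0) *)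
Definition erf (y : R) : R :=
  2 / Num.sqrt pi * Rintegral lebesgue_measure `[0, y] (fun t => expR (- (t ^+ 2))).

Definition rhostar_of (z : R) : R := 1 - erf (z / Num.sqrt 2).

Definition lpp (n : nat) (p : R) (v : 'I_n -> R) : R := \sum_(i < n) `|v i| `^ p.

Definition supp (n : nat) (x : 'I_n -> R) : {set 'I_n} := [set i | x i != 0].

Definition matvec (m n : nat) (A : 'I_m -> 'I_n -> R) (v : 'I_n -> R) : 'I_m -> R :=
  fun i => \sum_(j < n) A i j * v j.

Definition unique_lp_min (m n : nat) (p : R) (A : 'I_m -> 'I_n -> R) (x : 'I_n -> R) : Prop :=
  forall v : 'I_n -> R, matvec A v = matvec A x -> v <> x -> lpp p x < lpp p v.

Definition std_gaussian_rv d (T : measurableType d) (P : probability T R) (X : T -> R) : Prop :=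
  measurable_fun setT X /\
  forall B : set R, measurable B -> P (X @^-1` B) = normal_prob 0 1 B.

Definition mutually_independent d (T : measurableType d) (P : probability T R)
  (I : finType) (X : I -> T -> R) : Prop :=
  forall B : I -> set R, (forall i, measurable (B i)) ->
    P (\bigcap_(i in [set: I]) (X i @^-1` B i)) = (\prod_(i in [set: I]) P (X i @^-1` B i))%E.
End defs.

(* Main.v *)
(** Take a random [m x n] Gaussian matrix [A] with [k = n - m] small compared to [n], and an
    independent Gaussian vector [g].

    A single coordinatewise functional decides failure: with [t = z* ^ p],
    [sum_i 2 rho t + 2 (|g_i|^p - t)_+ - |g_i|^p] bounds
    [sum_(i in T) |g_i|^p - sum_(i notin T) |g_i|^p] for all [|T| <= rho n] at once, and has
    negative mean because [rho < rho*].  By Chernoff's bound it is exponentially unlikely to be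
    nonnegative, even after adding a slack [eps (1 + g_i^2)] which makes the failure cone robust:
    every [g] whose direction is close to that of a vector violating the null space property of
    order [rho n] is bad.

    Let [q(A, g)] say that [g] is close to [ker A] and [c(A) = P_g (q(A, g))].  By invariance of the
    Gaussian law under the reflections of [R^n], [E_A (q(A, g) / c(A))] does not depend on [g <> 0],
    hence is at most 1, so [E_A (P_g (g bad | q(A, g))) <= P_g (g bad)] is exponentially small.
    Reflections along vectors of [ker A] fix [A], so conditionally on [q] the small cones around
    unit vectors of [ker A] are equiprobable; [C^k] of them cover, so each has conditional
    probability at least [C^-k].  If [ker A] contains a violating vector, its cone consists of bad
    vectors, and Markov's inequality bounds the probability of this by [C^k P_g (g bad)]. *)
Require Import Defs.
From HB Require Import structures.
From mathcomp Require Import all_boot all_order all_algebra.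
From mathcomp Require Import all_classical all_reals all_analysis.
From mathcomp Require Import measurable_realfun normal_distribution.
From mathcomp Require Import ring lra.
Import Order.TTheory GRing.Theory Num.Theory.
Import numFieldNormedType.Exports.
Set Implicit Arguments. Unset Strict Implicit. Unset Printing Implicit Defensive.
Local Open Scope classical_set_scope.
Local Open Scope ring_scope.


(** * Finite powers of a probability measure *)

(** The threshold is the value of [rho] at which the mean vanishes: by the equation defining [zs],
    the part of E|g|^p carried by |g| >= [zs] is exactly half of it, which makes the mean of the
    functional equal to 2 t (rho - [rhostar_of zs]). The obstacle is uniformity, over all supports
    and over all vectors of a random subspace. The functional does not mention the support, so no
    count of supports is paid. The only union bound left runs over a net of the unit sphere of the
    kernel, whose base [C] depends on the cone width alone. Both [C] and the Chernoff rate are fixed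
    before the aspect ratio, so a small enough k/n leaves half of the rate. A kernel is a Gaussian
    null set, and its law as a random subspace would need an invariant measure on subspaces.
    Thickening it to the near-kernel vectors gives positive mass, so conditioning is division by a
    number, and the reflections, transitive on each sphere, are all the symmetry that is used. Their
    invariance comes from one-dimensional substitutions alone. *)

Definition tcons (T : Type) n (xt : T * n.-tuple T) : n.+1.-tuple T := [tuple of xt.1 :: xt.2].

Section power_measure.
Context d (T : measurableType d) (R : realType) (mu : probability T R).

Lemma measurable_tcons n : measurable_fun [set: T * n.-tuple T] (@tcons T n).
Proof. by apply: (measurable_cons (g := snd)) => //. Qed.

HB.instance Definition _ n := isMeasurableFun.Build _ _ _ _ (@tcons T n) (measurable_tcons (n := n)).

(** Splitting off the first coordinate lets Tonelli's theorem turn statements about [n]-fold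
    products into inductions on [n]. The construction serves twice: for vectors of reals, and for
    matrices as tuples of rows. *)
Fixpoint pow n : probability (n.-tuple T) R :=
  match n with
  | 0 => [the probability _ _ of \d_([tuple])]
  | n'.+1 => [the probability _ _ of distribution (mu \x pow n')%E (@tcons T n')]
  end.

Lemma integral_pow0 (f : 0.-tuple T -> \bar R) :
  measurable_fun [set: 0.-tuple T] f -> (\int[pow 0]_t f t = f [tuple])%E.
Proof. by move=> mf; rewrite /= integral_dirac// diracT mul1e. Qed.

Lemma integral_powS n (f : n.+1.-tuple T -> \bar R) :
  measurable_fun [set: n.+1.-tuple T] f -> (forall t, 0 <= f t)%E ->
  (\int[pow n.+1]_t f t = \int[mu]_x \int[pow n]_t f (tcons (x, t)))%E.
Proof.
move=> mf f0; rewrite /= ge0_integral_distribution// fubini_tonelli1//.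
- apply: measurableT_comp => //; exact: measurable_tcons.
- by move=> x; exact: f0.
Qed.

Lemma measurable_integral_tcons n (f : n.+1.-tuple T -> \bar R) :
  measurable_fun [set: n.+1.-tuple T] f -> (forall t, 0 <= f t)%E ->
  measurable_fun setT (fun x => \int[pow n]_t f (tcons (x, t)))%E.
Proof.
move=> mf f0; apply: (measurable_fun_fubini_tonelli_F (f \o @tcons T n)).
- apply: measurableT_comp => //; exact: measurable_tcons.
- by move=> x; exact: f0.
Qed.

Definition box n (B : 'I_n -> set T) : set (n.-tuple T) := [set t | forall i, B i (tnth t i)].

Lemma measurable_box n (B : 'I_n -> set T) : (forall i, measurable (B i)) -> measurable (box B).
Proof.
move=> mB; rewrite (_ : box B = \bigcap_(i in [set: 'I_n]) (@tnth n T ^~ i @^-1` B i)); last first.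
  by apply/seteqP; split => t /= h i => [_|]; exact: h.
apply: fin_bigcap_measurable => // i _.
by rewrite -[X in measurable X]setTI; apply: measurable_tnth.
Qed.

Lemma pow_box n (B : 'I_n -> set T) : (forall i, measurable (B i)) ->
  pow n (box B) = (\prod_(i < n) mu (B i))%E.
Proof.
elim: n B => [|n IH] B mB.
  by rewrite big_ord0 /= diracE mem_set// => -[].
rewrite big_ord_recl /= /distribution /pushforward.
rewrite (_ : _ @^-1` _ = B ord0 `*` box (fun i => B (lift ord0 i))); last first.
  apply/seteqP; split => -[x t] /=.
    move=> h; split; first by have := h ord0.
    by move=> i; have := h (lift ord0 i); rewrite tnthS.
  move=> [h0 h] i; case: (unliftP ord0 i) => [j ->|->//].
  by rewrite tnthS; exact: h.
rewrite product_measure1E//; last by exact: measurable_box.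
by congr (_ * _)%E; apply: IH.
Qed.

End power_measure.

Lemma box_setI d (T : measurableType d) n (B C : 'I_n -> set T) :
  box B `&` box C = box (fun i => B i `&` C i).
Proof.
by apply/seteqP; split => t /= => [[h1 h2] i|h]; split => // i; have [] := h i.
Qed.

(** Since [setT] is in [G], a cylinder over one coordinate is itself a box with sides in [G]; this
    links coordinate preimages to boxes. *)
Lemma measurable_tuple_generated d (T : measurableType d) n (G : set (set T)) :
  (@measurable _ T) = <<s G >> -> G setT ->
  (@measurable _ (n.-tuple T)) = <<s [set C | exists2 B : 'I_n -> set T, (forall i, G (B i)) & C = box B] >>.
Proof.
move=> mG GT; apply/seteqP; split.
- apply: smallest_sub; first exact: smallest_sigma_algebra.
  move=> A; rewrite -bigcup_seq/= => -[i _ [B mB <-]]; rewrite setTI.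
  move: B mB; rewrite /= -/(@measurable _ T) mG.
  apply: smallest_sub.
    split => /=.
    + by rewrite preimage_set0; exact: sigma_algebra0.
    + move=> B; rewrite !setTD preimage_setC; exact: sigma_algebraC.
    + by move=> F mF; rewrite preimage_bigcup; exact: sigma_algebra_bigcup.
  move=> B GB; apply: sub_sigma_algebra; exists (fun j => if j == i then B else setT).
    by move=> j; case: ifP.
  apply/seteqP; split => t /= h.
    by move=> j; case: eqP => // ->.
  by have := h i; rewrite eqxx.
- apply: smallest_sub; first exact: sigma_algebra_measurable.
  move=> _ [B GB ->]; apply: measurable_box => i.
  by rewrite mG; exact: sub_sigma_algebra.
Qed.

Lemma setI_closed_box d (T : measurableType d) n (G : set (set T)) : setI_closed G ->
  setI_closed [set C | exists2 B : 'I_n -> set T, (forall i, G (B i)) & C = box B].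
Proof.
move=> GI _ _ [B GB ->] [C GC ->]; rewrite box_setI; exists (fun i => B i `&` C i) => // i.
exact: GI.
Qed.

Lemma measure_unique_setT d (T : measurableType d) (R : realType) (G : set (set T))
  (m1 m2 : probability T R) : (@measurable _ T) = <<s G >> -> setI_closed G -> G setT ->
  (forall A, G A -> m1 A = m2 A) -> forall A, measurable A -> m1 A = m2 A.
Proof.
move=> mG GI GT mE; apply: (measure_unique G (fun=> setT)) => //.
  by rewrite bigcup_const.
by move=> _ /=; apply: le_lt_trans (probability_le1 m1 measurableT) _; rewrite ltry.
Qed.

Section pow_unique.
Context d (T : measurableType d) (R : realType).

(** Boxes with sides in [G] form a generating pi-system. Leaving [G] free matters for matrices,
    whose rows are tested only on boxes of reals. *)
Lemma pow_unique n (mu : probability T R) (Q : probability (n.-tuple T) R) (G : set (set T)) :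
  (@measurable _ T) = <<s G >> -> setI_closed G -> G setT ->
  (forall B : 'I_n -> set T, (forall i, G (B i)) -> Q (box B) = (\prod_(i < n) mu (B i))%E) ->
  forall A, measurable A -> Q A = pow mu n A.
Proof.
move=> mG GI GT QE; apply: (measure_unique_setT (measurable_tuple_generated n mG GT)).
- exact: setI_closed_box.
- exists (fun=> setT) => //; apply/seteqP; split => //.
- move=> _ [B GB ->]; rewrite QE// pow_box// => i.
  by rewrite mG; exact: sub_sigma_algebra.
Qed.

Lemma pow_map n (mu : probability T R) (f : T -> T) (mf : measurable_fun setT f) :
  (forall A, measurable A -> mu (f @^-1` A) = mu A) ->
  forall A, measurable A -> pow mu n ((@map_tuple n T T f) @^-1` A) = pow mu n A.
Proof.
move=> fmu A mA.
have mm : measurable_fun setT (@map_tuple n T T f).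
  apply/measurable_fun_tnthP => i.
  rewrite (_ : _ \o _ = f \o (fun t => tnth t i)); last by apply/funext => t /=; rewrite tnth_map.
  by apply: measurableT_comp => //; exact: measurable_tnth.
pose mfm : {mfun n.-tuple T >-> n.-tuple T} := HB.pack (@map_tuple n T T f) (isMeasurableFun.Build _ _ _ _ _ mm).
transitivity (distribution (pow mu n) mfm A) => //.
apply: (pow_unique (G := measurable)) => //.
- exact/esym/sigma_algebra_id/sigma_algebra_measurable.
- exact: measurableI.
move=> B mB /=; rewrite /distribution /pushforward.
rewrite (_ : _ @^-1` _ = box (fun i => f @^-1` B i)); last first.
  by apply/seteqP; split => t /= h i; have := h i; rewrite tnth_map.
have mfB i : measurable (f @^-1` B i) by rewrite -[X in measurable X]setTI; exact: mf.
by rewrite pow_box//; apply: eq_bigr => i _; rewrite fmu.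
Qed.

End pow_unique.

(** * Euclidean geometry and reflections *)

Section euclidean.
Variable R : realType.

Definition nrm2 n (v : 'cV[R]_n) : R := \sum_i v i 0 ^+ 2.
Definition enorm n (v : 'cV[R]_n) : R := Num.sqrt (nrm2 v).

Lemma nrm2E n (v : 'cV[R]_n) : nrm2 v = (v^T *m v) 0 0.
Proof. by rewrite mxE; apply: eq_bigr => i _; rewrite mxE expr2. Qed.

Lemma nrm2_ge0 n (v : 'cV[R]_n) : 0 <= nrm2 v.
Proof. by apply: sumr_ge0 => i _; rewrite sqr_ge0. Qed.

Lemma nrm2_eq0 n (v : 'cV[R]_n) : (nrm2 v == 0) = (v == 0).
Proof.
apply/eqP/eqP => [h|->]; last by rewrite /nrm2 big1// => i _; rewrite mxE expr0n.
apply/colP => i; rewrite mxE; apply/eqP; rewrite -sqrf_eq0.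
move/eqP: h; rewrite /nrm2 psumr_eq0; last by move=> j _; rewrite sqr_ge0.
by move/allP => /(_ i (mem_index_enum _)).
Qed.

Lemma nrm2Z n a (v : 'cV[R]_n) : nrm2 (a *: v) = a ^+ 2 * nrm2 v.
Proof. by rewrite /nrm2 mulr_sumr; apply: eq_bigr => i _; rewrite mxE exprMn. Qed.

Lemma nrm2N n (v : 'cV[R]_n) : nrm2 (- v) = nrm2 v.
Proof. by rewrite -scaleN1r nrm2Z sqrrN expr1n mul1r. Qed.

Definition dot n (u v : 'cV[R]_n) : R := (u^T *m v) 0 0.

Lemma dotC n (u v : 'cV[R]_n) : dot u v = dot v u.
Proof. by rewrite /dot !mxE; apply: eq_bigr => i _; rewrite !mxE mulrC. Qed.

Lemma dotZr n a (u v : 'cV[R]_n) : dot u (a *: v) = a * dot u v.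
Proof. by rewrite /dot -scalemxAr mxE. Qed.

Lemma dotZl n a (u v : 'cV[R]_n) : dot (a *: u) v = a * dot u v.
Proof. by rewrite dotC dotZr dotC. Qed.

Lemma dotBr n (u v w : 'cV[R]_n) : dot u (v - w) = dot u v - dot u w.
Proof. by rewrite /dot mulmxBr [LHS]mxE [X in _ + X]mxE. Qed.

Lemma nrm2D n (u v : 'cV[R]_n) : nrm2 (u + v) = nrm2 u + 2 * dot u v + nrm2 v.
Proof.
rewrite /nrm2 /dot mxE mulr_sumr -!big_split/=.
by apply: eq_bigr => i _; rewrite !mxE; ring.
Qed.

Lemma nrm2B n (u v : 'cV[R]_n) : nrm2 (u - v) = nrm2 u - 2 * dot u v + nrm2 v.
Proof. by rewrite nrm2D nrm2N /dot mulmxN mxE mulrN. Qed.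

Lemma cauchy_schwarz n (u v : 'cV[R]_n) : dot u v ^+ 2 <= nrm2 u * nrm2 v.
Proof.
have [->|v0] := eqVneq v 0.
  by rewrite /dot mulmx0 mxE expr0n mulr_ge0 ?nrm2_ge0.
have nv : 0 < nrm2 v by rewrite lt_neqAle nrm2_ge0 eq_sym nrm2_eq0 v0.
have := nrm2_ge0 (nrm2 v *: u - dot u v *: v).
rewrite nrm2B !nrm2Z dotZl dotZr.
move=> h; have : 0 <= nrm2 v * (nrm2 u * nrm2 v - dot u v ^+ 2) by nra.
by rewrite pmulr_rge0// subr_ge0.
Qed.

Lemma enorm_ge0 n (v : 'cV[R]_n) : 0 <= enorm v. Proof. exact: sqrtr_ge0. Qed.

Lemma sqr_enorm n (v : 'cV[R]_n) : enorm v ^+ 2 = nrm2 v.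
Proof. by rewrite sqr_sqrtr ?nrm2_ge0. Qed.

Lemma enorm_eq0 n (v : 'cV[R]_n) : (enorm v == 0) = (v == 0).
Proof. by rewrite -nrm2_eq0 -sqr_enorm sqrf_eq0. Qed.

Lemma enorm_gt0 n (v : 'cV[R]_n) : (0 < enorm v) = (v != 0).
Proof. by rewrite lt_neqAle enorm_ge0 andbT eq_sym enorm_eq0. Qed.

Lemma enormZ n a (v : 'cV[R]_n) : enorm (a *: v) = `|a| * enorm v.
Proof. by rewrite /enorm nrm2Z sqrtrM ?sqr_ge0// sqrtr_sqr. Qed.

Lemma enormN n (v : 'cV[R]_n) : enorm (- v) = enorm v.
Proof. by rewrite /enorm nrm2N. Qed.

Lemma enormD n (u v : 'cV[R]_n) : enorm (u + v) <= enorm u + enorm v.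
Proof.
rewrite -(@ler_pXn2r _ 2)// ?nnegrE ?addr_ge0 ?enorm_ge0//.
rewrite sqr_enorm nrm2D sqrrD !sqr_enorm lerD2r lerD2l -[leRHS]mulr_natl.
rewrite ler_pM2l//; apply: le_trans (ler_norm _) _.
rewrite -(@ler_pXn2r _ 2)// ?nnegrE ?mulr_ge0 ?enorm_ge0//.
by rewrite exprMn !sqr_enorm real_normK ?num_real// cauchy_schwarz.
Qed.

Lemma le_enorm n (v : 'cV[R]_n) c : 0 <= c -> (enorm v <= c) = (nrm2 v <= c ^+ 2).
Proof. by move=> c0; rewrite -sqr_enorm ler_pXn2r// nnegrE enorm_ge0. Qed.

Lemma enorm_unit n (v : 'cV[R]_n) : v != 0 -> enorm ((enorm v)^-1 *: v) = 1.
Proof.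
move=> v0; rewrite enormZ ger0_norm ?invr_ge0 ?enorm_ge0// mulVf//.
by rewrite enorm_eq0.
Qed.

(** The Householder reflection in the hyperplane orthogonal to [z]. For [z = 0] it is the identity,
    so the lemmas on it need no hypothesis on [z]. *)
Definition refl n (z : 'cV[R]_n) : 'M[R]_n := 1%:M - (2 / nrm2 z) *: (z *m z^T).

Lemma mul_refl n (z x : 'cV[R]_n) : refl z *m x = x - (2 / nrm2 z * dot z x) *: z.
Proof.
rewrite /refl mulmxBl mul1mx -scalemxAl -mulmxA.
by rewrite [z^T *m x]mx11_scalar mul_mx_scalar scalerA.
Qed.

Lemma tr_refl n (z : 'cV[R]_n) : (refl z)^T = refl z.
Proof. by rewrite /refl linearB/= trmx1 linearZ/= trmx_mul trmxK. Qed.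

Lemma reflK n (z : 'cV[R]_n) : refl z *m refl z = 1%:M.
Proof.
rewrite {1}/refl mulmxBl mul1mx -scalemxAl -mulmxA.
have -> : z^T *m refl z = - z^T.
  apply: trmx_inj; rewrite trmx_mul tr_refl trmxK linearN/= trmxK mul_refl.
  have [->|z0] := eqVneq z 0; first by rewrite scaler0 subr0 oppr0.
  rewrite /dot -nrm2E -mulrA mulVf ?nrm2_eq0// mulr1 scaler_nat mulr2n.
  by rewrite opprD addrA subrr add0r.
by rewrite mulmxN scalerN opprK /refl subrK.
Qed.

Lemma dot_mull n m (M : 'M[R]_(m, n)) u v : dot (M *m u) v = dot u (M^T *m v).
Proof. by rewrite /dot trmx_mul mulmxA. Qed.

Lemma nrm2_refl n (z x : 'cV[R]_n) : nrm2 (refl z *m x) = nrm2 x.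
Proof.
by rewrite !nrm2E -!/(dot _ _) dot_mull tr_refl mulmxA reflK mul1mx.
Qed.

Lemma enorm_refl n (z x : 'cV[R]_n) : enorm (refl z *m x) = enorm x.
Proof. by rewrite /enorm nrm2_refl. Qed.

(** For equal lengths, [nrm2 (u - v)] is twice [dot (u - v) u]. This is the transitivity of
    reflections on spheres. *)
Lemma refl_swap n (u v : 'cV[R]_n) : nrm2 u = nrm2 v -> refl (u - v) *m u = v.
Proof.
move=> uv; have [->|] := eqVneq u v.
  by rewrite subrr mul_refl scaler0 subr0.
rewrite -subr_eq0 => z0; rewrite mul_refl.
have e : nrm2 (u - v) = 2 * dot (u - v) u.
  by rewrite nrm2B -uv [dot (u - v) u]dotC dotBr /dot -nrm2E -/(dot _ _); ring.
rewrite mulrAC -e divff ?nrm2_eq0// scale1r opprB addrC subrK//.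
Qed.

Lemma mul_refl_ker n m (A : 'M[R]_(m, n)) z : A *m z = 0 -> A *m refl z = A.
Proof.
by move=> Az; rewrite /refl mulmxBr mulmx1 -scalemxAr mulmxA Az mul0mx scaler0 subr0.
Qed.

End euclidean.

(** * Vectors close to the kernel of a matrix *)

Section kernel_geometry.
Variable R : realType.

Definition gram m n (A : 'M[R]_(m, n)) : 'M[R]_m := A *m A^T.

(* [\det (gram A)] times the orthogonal projection of [g] on the row space of [A] *)
Definition rowpart m n (A : 'M[R]_(m, n)) (g : 'cV[R]_n) : 'cV[R]_n :=
  A^T *m (\adj (gram A) *m (A *m g)).

(** For [A] of full row rank and [delta >= 0]: the distance from [g] to the kernel is at most
    [delta * enorm g]. Multiplying through by the Gram determinant leaves only polynomials in the
    entries, hence an evidently measurable condition. *)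
Definition nearker m n (delta : R) (A : 'M[R]_(m, n)) (g : 'cV[R]_n) : bool :=
  (\det (gram A) != 0) &&
  (nrm2 (rowpart A g) <= delta ^+ 2 * nrm2 g * \det (gram A) ^+ 2).

Lemma gram_mulmx m n (A : 'M[R]_(m, n)) (H : 'M[R]_n) : H *m H^T = 1%:M ->
  gram (A *m H) = gram A.
Proof. by move=> HH; rewrite /gram trmx_mul mulmxA -(mulmxA A) HH mulmx1. Qed.

Lemma nearker_refl m n delta (A : 'M[R]_(m, n)) z g :
  nearker delta (A *m refl z) (refl z *m g) = nearker delta A g.
Proof.
rewrite /nearker /rowpart gram_mulmx ?tr_refl ?reflK//.
by rewrite trmx_mul tr_refl -!mulmxA (mulmxA (refl z) (refl z)) reflK mul1mx !nrm2_refl.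
Qed.

Lemma nearkerZ m n delta (A : 'M[R]_(m, n)) t g : t != 0 ->
  nearker delta A (t *: g) = nearker delta A g.
Proof.
move=> t0; rewrite /nearker /rowpart -!scalemxAr !nrm2Z; congr (_ && _).
rewrite [leRHS](_ : _ = t ^+ 2 * (delta ^+ 2 * nrm2 g * \det (gram A) ^+ 2)); last by ring.
by rewrite ler_pM2l// exprn_even_gt0.
Qed.

Lemma nearkerP m n delta (A : 'M[R]_(m, n)) g : 0 <= delta -> nearker delta A g ->
  exists2 h, A *m h = 0 & enorm (g - h) <= delta * enorm g.
Proof.
move=> d0 /andP[D0 le]; exists (g - (\det (gram A))^-1 *: rowpart A g).
  rewrite mulmxBr -scalemxAr /rowpart mulmxA -/(gram A) mulmxA mul_mx_adj.
  by rewrite mul_scalar_mx scalerA mulVf// scale1r subrr.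
rewrite subKr le_enorm ?mulr_ge0 ?enorm_ge0// nrm2Z exprMn sqr_enorm.
by rewrite exprVn mulrC ler_pdivrMr// exprn_even_gt0.
Qed.

Lemma nrm2_mulmx_le m n (M : 'M[R]_(m, n)) (v : 'cV[R]_n) :
  nrm2 (M *m v) <= (\sum_i nrm2 (row i M)^T) * nrm2 v.
Proof.
rewrite mulr_suml; apply: ler_sum => i _.
have -> : (M *m v) i 0 = dot (row i M)^T v by rewrite /dot trmxK -row_mul [RHS]mxE.
exact: cauchy_schwarz.
Qed.

(** Openness around kernel vectors, from which the near-kernel set gets positive Gaussian mass. The
    matrix [M], a multiple of the projection on the row space, kills [h], so that [rowpart A g] is
    [M *m (g - h)]. *)
Lemma nearker_nbhs m n (delta : R) (A : 'M[R]_(m, n)) (h : 'cV[R]_n) : 0 < delta -> \det (gram A) != 0 ->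
  A *m h = 0 -> h != 0 ->
  exists2 e, 0 < e & forall g : 'cV[R]_n, (forall i, `|g i 0 - h i 0| <= e) -> nearker delta A g.
Proof.
move=> d0 D0 Ah h0.
set M := A^T *m (\adj (gram A) *m A).
have ME g : rowpart A g = M *m g by rewrite /rowpart /M -!mulmxA.
have [C [C1 CE]] : exists C, 1 <= C /\ \sum_i nrm2 (row i M)^T <= C.
  exists (1 + \sum_i nrm2 (row i M)^T); split; last by rewrite lerDr.
  by rewrite lerDl sumr_ge0// => i _; exact: nrm2_ge0.
have C0 : 0 < C by exact: lt_le_trans ltr01 C1.
have eh : 0 < enorm h by rewrite enorm_gt0.
have [c [c0 cE]] : exists c, 0 < c /\ c = delta * `|\det (gram A)|.
  by exists (delta * `|\det (gram A)|); rewrite mulr_gt0// normr_gt0.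
(* With [|g - h| <= c |h| / (C + c)] one gets [C |g - h| <= c (|h| - |g - h|) <= c |g|], the bound
   wanted since [C] dominates the operator norm of [M]. *)
pose e2 := (c * enorm h / (C + c)) ^+ 2.
have e20 : 0 < e2.
  apply: exprn_gt0; apply: divr_gt0; first exact: mulr_gt0.
  exact: addr_gt0.
pose e := Num.sqrt (e2 / n.+1%:R).
have /ltW e2n : 0 < e2 / n.+1%:R by rewrite divr_gt0// ltr0n.
have e0 : 0 < e by rewrite sqrtr_gt0 divr_gt0// ltr0n.
exists e => // g gh; rewrite /nearker D0/=.
have ngh : enorm (g - h) <= c * enorm h / (C + c).
  rewrite le_enorm; last by rewrite divr_ge0 ?addr_ge0 ?mulr_ge0 ?enorm_ge0 ?ltW//.
  rewrite -/e2; apply: (@le_trans _ _ (\sum_(i < n) (e2 / n.+1%:R))).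
    apply: ler_sum => i _; rewrite !mxE -real_normK ?num_real//.
    rewrite -[leRHS]sqr_sqrtr//.
    by rewrite ler_pXn2r ?nnegrE// ?ltW// gh.
  rewrite sumr_const card_ord -(mulr_natr _ n) -mulrA; apply: ler_piMr; first exact: ltW.
  by rewrite mulrC ler_pdivrMr ?ltr0n// mul1r ler_nat.
have -> : delta ^+ 2 * nrm2 g * \det (gram A) ^+ 2 = (c * enorm g) ^+ 2.
  by rewrite cE !exprMn real_normK ?num_real// sqr_enorm mulrAC.
rewrite -le_enorm ?mulr_ge0 ?enorm_ge0//; last exact: ltW.
rewrite ME.
have -> : M *m g = M *m (g - h).
  by rewrite mulmxBr /M -!mulmxA Ah !mulmx0 subr0.
apply: (@le_trans _ _ (C * enorm (g - h))).
  rewrite le_enorm ?mulr_ge0 ?enorm_ge0//; last exact: ltW.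
  rewrite exprMn sqr_enorm.
  apply: le_trans (nrm2_mulmx_le _ _) _; rewrite ler_wpM2r ?nrm2_ge0//.
  by move: CE => /le_trans; apply; rewrite expr2 ler_peMl//; exact: ltW.
have hg : enorm h <= enorm g + enorm (g - h).
  by rewrite -[X in enorm X <= _](subKr g) (le_trans (enormD _ _))// enormN.
have : (C + c) * enorm (g - h) <= c * enorm h.
  by rewrite -ler_pdivlMl ?addr_gt0// mulrC.
rewrite mulrDl; have : c * enorm h <= c * (enorm g + enorm (g - h)) by rewrite ler_pM2l.
by rewrite mulrDr; lra.
Qed.

Lemma row_free_ker m n (A : 'M[R]_(m, n)) :
  (forall u : 'rV_m, u *m A = 0 -> u = 0) -> row_free A.
Proof.
move=> h; rewrite -kermx_eq0; apply/eqP/row_matrixP => i; rewrite row0; apply: h.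
by apply/sub_kermxP; exact: row_sub.
Qed.

Lemma exists_ker m n (A : 'M[R]_(m, n)) : (\rank A < n)%N -> exists2 x : 'cV_n, x != 0 & A *m x = 0.
Proof.
move=> rA; have : kermx A^T != 0.
  by rewrite kermx_eq0 /row_free mxrank_tr neq_ltn rA.
case/rowV0Pn => v /sub_kermxP vA v0; exists v^T; first by rewrite trmx_eq0.
by apply: trmx_inj; rewrite trmx_mul trmxK vA trmx0.
Qed.

(** Induction on the dimension of the kernel: a unit kernel vector [v] is the next basis vector, and
    appending [v^T] as a row to [A] cuts the kernel down to the orthogonal complement of [v] in
    it. *)
Lemma ker_orthobasis k m n (A : 'M[R]_(m, n)) : row_free A -> (m + k = n)%N ->
  exists V : 'M[R]_(n, k), [/\ V^T *m V = 1%:M, A *m V = 0 &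
    forall x : 'cV_n, A *m x = 0 -> x = V *m (V^T *m x)].
Proof.
elim: k m A => [|k IH] m A fA mk.
  exists 0; split; first by apply/matrixP => -[].
    by rewrite mulmx0.
  move=> x Ax; rewrite mul0mx; rewrite addn0 in mk; subst m.
  have uA : A \in unitmx by rewrite -row_free_unit.
  by rewrite -[x](mulKmx uA) Ax mulmx0.
have [x x0 Ax] : exists2 x : 'cV_n, x != 0 & A *m x = 0.
  by apply: exists_ker; rewrite (eqP fA) -[X in (_ < X)%N]mk addnS ltnS leq_addr.
pose v := (enorm x)^-1 *: x.
have Av : A *m v = 0 by rewrite /v -scalemxAr Ax scaler0.
have vv : v^T *m v = 1%:M.
  by rewrite [LHS]mx11_scalar -nrm2E -sqr_enorm enorm_unit// expr1n.
have fA' : row_free (col_mx A v^T).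
  apply: row_free_ker => u; rewrite -[u]hsubmxK mul_row_col => h.
  have h2 : rsubmx u = 0.
    have := congr1 (mulmx^~ v) h.
    by rewrite /= mul0mx mulmxDl -!mulmxA Av mulmx0 add0r vv mulmx1.
  move: h; rewrite h2 mul0mx addr0 => h1.
  have -> : lsubmx u = 0.
    by move: fA => /row_free_inj inj; apply: inj; rewrite h1 mul0mx.
  by rewrite row_mx0.
have [|V [VV AV xV]] := IH _ (col_mx A v^T) fA'; first by rewrite -addnA add1n.
move: AV; rewrite mul_col_mx => /eqP; rewrite col_mx_eq0 => /andP[/eqP AV /eqP vV].
have Vv : V^T *m v = 0 by apply: trmx_inj; rewrite trmx_mul trmxK vV trmx0.
suff : exists V : 'M[R]_(n, 1 + k), [/\ V^T *m V = 1%:M, A *m V = 0 &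
    forall x : 'cV_n, A *m x = 0 -> x = V *m (V^T *m x)] by [].
exists (row_mx v V); split.
- by rewrite tr_row_mx mul_col_row vv vV Vv VV -scalar_mx_block.
- by rewrite mul_mx_row Av AV row_mx0.
move=> y Ay; rewrite tr_row_mx mul_col_mx mul_row_col.
have := xV (y - v *m (v^T *m y)); rewrite mul_col_mx mulmxBr (mulmxA A) Av mul0mx Ay subrr.
rewrite mulmxBr (mulmxA v^T) vv mul1mx subrr col_mx0 => /(_ erefl).
rewrite mulmxBr (mulmxA V^T v) Vv mul0mx subr0 => <-.
by rewrite addrC subrK.
Qed.

Lemma row_free_gram m n (A : 'M[R]_(m, n)) : \det (gram A) != 0 -> row_free A.
Proof.
move=> D; apply: row_free_ker => u uA.
have uG : gram A \in unitmx by rewrite unitmxE unitfE.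
by rewrite -[u](mulmxK uG) /gram mulmxA uA !mul0mx.
Qed.

Lemma gram_row_free m n (A : 'M[R]_(m, n)) : row_free A -> \det (gram A) != 0.
Proof.
move=> fA; rewrite -unitfE -unitmxE -row_free_unit; apply: row_free_ker => u uG.
move/row_free_inj: fA => inj; apply: inj; rewrite mul0mx.
apply: trmx_inj; rewrite trmx0; apply/eqP; rewrite -nrm2_eq0 nrm2E trmxK trmx_mul.
by rewrite !mulmxA -(mulmxA u) uG mul0mx mxE.
Qed.

End kernel_geometry.

(** * Nets of Euclidean spheres *)

Section sphere_net.
Variable R : realType.

(* Weighting a code by [\prod_i 2^-n_i], whose total mass is at most [4^k]. *)
Lemma card_codes k L :
  (#|[set f : {ffun 'I_k -> bool * 'I_L.+1} | (\sum_i (f i).2 <= L)%N]| <= 4 ^ k * 2 ^ L)%N.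
Proof.
set S := [set f | _].
suff : #|S|%:R * (2 ^- L) <= (4 ^ k)%:R :> R.
  rewrite ler_pdivrMr ?exprn_gt0//.
  by rewrite -natrX -natrM ler_nat.
apply: (@le_trans _ _ (\sum_(f : {ffun 'I_k -> bool * 'I_L.+1}) \prod_(i < k) 2 ^- (f i).2)).
  rewrite mulr_natl -sumr_const [leRHS](bigID (mem S))/= -[leLHS]addr0 lerD//; last first.
    by apply: sumr_ge0 => f _; apply: prodr_ge0 => i _; rewrite invr_ge0 exprn_ge0.
  apply: ler_sum => f; rewrite inE => fL.
  rewrite prodfV prodrXr lef_pV2 ?posrE ?exprn_gt0//.
  by rewrite ler_eXn2l// ltr1n.
rewrite -(bigA_distr_bigA (fun (i : 'I_k) (c : bool * 'I_L.+1) => 2 ^- c.2 : R))/=.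
rewrite prodr_const card_ord natrX lerXn2r ?nnegrE ?ler0n//.
  by apply: sumr_ge0 => c _; rewrite invr_ge0 exprn_ge0.
rewrite -(pair_big xpredT xpredT (fun (b : bool) (j : 'I_L.+1) => 2 ^- j : R))/=.
rewrite big_bool/= -mulr2n -[leRHS]/((2 * 2)%:R) natrM mulr_natl ler_wMn2r//.
suff -> : \sum_(i < L.+1) 2 ^- i = 2 - 2 ^- L :> R.
  by rewrite lerBlDr lerDl invr_ge0 exprn_ge0.
elim: L {S} => [|L IH]; first by rewrite big_ord_recl big_ord0 expr0 invr1; lra.
rewrite big_ord_recr /= IH exprS invfM.
set x := _^-1 in IH *. by lra.
Qed.

(** A counting argument replaces volumes. Coordinates are rounded to the grid of mesh
    [eta / sqrt k], so that equal codes force distance at most [eta]. On the sphere the rounded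
    values add up to at most [B * k], and [card_codes] bounds the number of such codes by
    [4 ^ k * 2 ^ (B * k)]. *)
Lemma sphere_net (eta : R) : 0 < eta -> exists C : nat, forall k,
  exists s : seq 'cV[R]_k, [/\ (size s <= C ^ k)%N, (forall b, b \in s -> enorm b = 1) &
    forall a : 'cV[R]_k, enorm a = 1 -> exists2 b, b \in s & enorm (a - b) <= eta].
Proof.
move=> eta0; pose B := (Num.trunc (eta^-1)).+1.
have Beta : eta^-1 <= B%:R by apply/ltW; rewrite /B truncnS_gt.
exists (4 * 2 ^ B)%N => k; pose L := (B * k)%N.
pose sc := Num.sqrt k%:R / eta : R.
have sc0 : 0 <= sc by rewrite divr_ge0 ?sqrtr_ge0 ?ltW.
pose T := (bool * 'I_L.+1)%type.
pose code (a : 'cV[R]_k) : {ffun 'I_k -> T} :=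
  [ffun i => (0 <= a i 0, inord (Num.trunc (`|a i 0| * sc)))].
(* From [2 sqrt k |a_i| <= k a_i^2 + 1]; summed over a unit vector the right-hand side is [2 k], so
   the total is at most [k / eta <= B k]. *)
have sum_trunc (a : 'cV[R]_k) : enorm a = 1 -> (\sum_i Num.trunc (`|a i 0| * sc)%R <= L)%N.
  move=> a1; rewrite -(ler_nat R) natr_sum.
  apply: (@le_trans _ _ (\sum_i ((k%:R * a i 0 ^+ 2 + 1) / (2 * eta)))).
    apply: ler_sum => i _; apply: (@le_trans _ _ (`|a i 0| * sc)).
      by rewrite truncn_le// mulr_ge0.
    rewrite /sc mulrA invfM mulrA ler_pM2r ?invr_gt0//.
    have hs : Num.sqrt k%:R ^+ 2 = k%:R :> R by rewrite sqr_sqrtr.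
    rewrite -(real_normK (num_real (a i 0))) ler_pdivlMr// -[X in X * _ ^+ 2]hs.
    have := sqr_ge0 (Num.sqrt k%:R * `|a i 0| - 1 : R); nra.
  rewrite -mulr_suml big_split/= -mulr_sumr sumr_const card_ord.
  rewrite -/(nrm2 a) -sqr_enorm a1 expr1n mulr1 -mulr2n.
  rewrite -[k%:R *+ 2]mulr_natl invfM mulrACA divff// mul1r /L natrM mulrC.
  by rewrite ler_wpM2r.
have codeE (a : 'cV[R]_k) i : enorm a = 1 -> (code a i).2 = Num.trunc (`|a i 0| * sc) :> nat.
  move=> a1; rewrite ffunE/= inordK// ltnS; apply: leq_trans (sum_trunc a a1).
  by rewrite (bigD1 i)//= leq_addr.
have codeS (a : 'cV[R]_k) : enorm a = 1 -> code a \in [set f : {ffun 'I_k -> T} | (\sum_i (f i).2 <= L)%N].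
  move=> a1; rewrite inE; apply: leq_trans (sum_trunc a a1).
  by apply: leq_sum => i _; rewrite codeE.
have near (a b : 'cV[R]_k) : enorm a = 1 -> enorm b = 1 -> code a = code b -> enorm (a - b) <= eta.
  move=> a1 b1 ab; rewrite le_enorm ?(ltW eta0)//.
  have [k0|k0] := posnP k.
    move: k0 a b {a1 b1 ab}; clear; move=> -> a b.
    by rewrite /nrm2 big_ord0 sqr_ge0.
  have scp : 0 < sc by rewrite divr_gt0// sqrtr_gt0 ltr0n.
  have kR : 0 < k%:R :> R by rewrite ltr0n.
  apply: (@le_trans _ _ (\sum_(i < k) (eta ^+ 2 / k%:R))); last first.
    by rewrite sumr_const card_ord -[leLHS](mulr_natr _ k) divfK// gt_eqF.
  apply: ler_sum => i _.
  have -> : eta ^+ 2 / k%:R = sc^-1 ^+ 2.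
    by rewrite /sc invf_div expr_div_n sqr_sqrtr// ltW.
  rewrite !mxE -real_normK ?num_real// ler_pXn2r ?nnegrE ?invr_ge0//.
  have e2 : Num.trunc (`|a i 0| * sc) = Num.trunc (`|b i 0| * sc).
    by rewrite -!codeE// ab.
  have e1 : (0 <= a i 0) = (0 <= b i 0).
    by have := congr1 (fun f : {ffun 'I_k -> T} => (f i).1) ab; rewrite !ffunE.
  have : `| `|a i 0| * sc - `|b i 0| * sc | <= 1.
    have /andP[a2 a3] := truncn_itv (mulr_ge0 (normr_ge0 (a i 0)) sc0).
    have /andP[b2 b3] := truncn_itv (mulr_ge0 (normr_ge0 (b i 0)) sc0).
    move: a2 a3 b2 b3; rewrite e2 -natr1 => a2 a3 b2 b3.
    rewrite ler_norml; apply/andP; split; lra.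
  rewrite -mulrBl normrM (ger0_norm sc0) -ler_pdivlMr// mul1r; apply: le_trans.
  case: (lerP 0 (a i 0)) e1 => [a0|a0] /esym => [b0|/negbT].
    by rewrite (ger0_norm a0) (ger0_norm b0).
  by rewrite -ltNge => b0; rewrite (ltr0_norm a0) (ltr0_norm b0) -opprD normrN.
(* One unit vector is chosen for each code that some unit vector has, so that net points lie on the
   sphere itself. *)
pose pick (f : {ffun 'I_k -> T}) : seq 'cV[R]_k :=
  if pselect (exists a, enorm a = 1 /\ code a = f) is left h then [:: projT1 (cid h)] else [::].
exists (flatten [seq pick f | f <- enum [set f : {ffun 'I_k -> T} | (\sum_i (f i).2 <= L)%N]]).
split.
- apply: leq_trans (leq_trans _ (card_codes k L)) _; last first.
    by rewrite expnMn -expnM /L.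
  rewrite size_flatten /shape -map_comp cardE.
  elim: (enum _) => //= f l IH; rewrite -[(size l).+1]add1n leq_add//.
  by rewrite /pick; case: pselect.
- move=> b /flatten_mapP[f _]; rewrite /pick; case: pselect => // h.
  by rewrite inE => /eqP ->; case: cid => /= a [].
- move=> a a1; have h : exists a', enorm a' = 1 /\ code a' = code a by exists a.
  exists (projT1 (cid h)).
    apply/flatten_mapP; exists (code a); first by rewrite mem_enum codeS.
    by rewrite /pick; case: pselect => // h'; rewrite (Prop_irrelevance h h') inE.
  by case: cid => /= a' [a'1 a'c]; exact: near.
Qed.

End sphere_net.

(** * Densities and affine changes of variable *)

Section normal_density.
Variable R : realType.
Local Notation leb := (@lebesgue_measure R).
Local Notation N01 := (@normal_prob R 0 1).
Local Notation pdf := (@normal_pdf R 0 1).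

Import HBNNSimple.

(** The usual extension from indicators: simple functions first, then monotone limits on both
    sides. *)
Lemma integral_density d (T : measurableType d) (mu nu : {measure set T -> \bar R}) (g : T -> R) :
  measurable_fun [set: T] g -> (forall x, 0 <= g x) ->
  (forall A, measurable A -> nu A = \int[mu]_(x in A) (g x)%:E)%E ->
  forall f : T -> \bar R, measurable_fun [set: T] f -> (forall x, 0 <= f x)%E ->
  (\int[nu]_x f x = \int[mu]_x (f x * (g x)%:E))%E.
Proof.
move=> mg g0 nuE f mf f0.
pose F := nnsfun_approx measurableT mf.
transitivity (limn (fun n => \int[nu]_x (F n x)%:E))%E.
  rewrite -monotone_convergence//.
  - apply: eq_integral => y _; apply/esym/cvg_lim => //.
    by apply: cvg_nnsfun_approx.
  - by move=> n; exact/measurable_EFinP/measurable_funP.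
  - by move=> n y _; rewrite lee_fin fun_ge0.
  - by move=> y _ m n mn; rewrite lee_fin; exact/lefP/nd_nnsfun_approx.
transitivity (limn (fun n => \int[mu]_x ((F n x)%:E * (g x)%:E)))%E; last first.
  rewrite -monotone_convergence//.
  - apply: eq_integral => y _; apply/cvg_lim => //.
    apply: cvgeMr => //; exact: cvg_nnsfun_approx.
  - move=> n; apply: emeasurable_funM; last exact/measurable_EFinP.
    exact/measurable_EFinP/measurable_funP.
  - by move=> n y _; rewrite -EFinM lee_fin mulr_ge0// fun_ge0.
  - move=> y _ m n mn; rewrite -!EFinM lee_fin ler_wpM2r//.
    exact/lefP/nd_nnsfun_approx.
congr (limn _); apply/funext => n.
transitivity (\sum_(k \in range (F n)) (\int[nu]_x (k * \1_(F n @^-1` [set k]) x)%:E))%E.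
  under eq_integral do rewrite fimfunE -fsumEFin//.
  rewrite ge0_integral_fsum//.
  - by move=> y; exact/measurable_EFinP/measurable_funM.
  - by move=> y x _; rewrite nnfun_muleindic_ge0.
transitivity (\sum_(k \in range (F n)) (\int[mu]_x ((k * \1_(F n @^-1` [set k]) x)%:E * (g x)%:E)))%E; last first.
  rewrite -ge0_integral_fsum//.
  - apply: eq_integral => x _; rewrite -ge0_mule_fsuml; last first.
      by move=> k; rewrite nnfun_muleindic_ge0.
    by rewrite fsumEFin// -fimfunE.
  - move=> y; apply: emeasurable_funM; last exact/measurable_EFinP.
    exact/measurable_EFinP/measurable_funM.
  - by move=> y x _; rewrite mule_ge0 ?nnfun_muleindic_ge0// lee_fin.
apply: eq_fsbigr => k; rewrite inE => -[z _ Fz].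
have k0 : 0 <= k by rewrite -Fz fun_ge0.
under eq_integral do rewrite EFinM.
rewrite ge0_integralZl_EFin//; last by apply/measurable_EFinP.
rewrite integral_indic// setIT nuE//.
under [in RHS]eq_integral do rewrite EFinM -muleA.
rewrite ge0_integralZl_EFin//; last 2 first.
  - by move=> x _; rewrite -EFinM lee_fin mulr_ge0.
  - by apply: emeasurable_funM; exact/measurable_EFinP.
congr (_ * _)%E; rewrite integral_mkcond; apply: eq_integral => x _.
by rewrite patchE indicE; case: (x \in _); rewrite ?mul1e ?mul0e.
Qed.

Lemma integral_normal_prob (f : R -> \bar R) : measurable_fun [set: R] f -> (forall x, 0 <= f x)%E ->
  (\int[N01]_x f x = \int[leb]_x (f x * (pdf x)%:E))%E.
Proof.
apply: (integral_density (mu := leb) (nu := N01)) => //.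
- exact: measurable_normal_pdf.
- by move=> x; exact: normal_pdf_ge0.
Qed.

Lemma preimage_affine_itv (a b c d : R) : a != 0 ->
  leb ((fun x => a * x + b)%R @^-1` `]c, d]) =
  (if (c < d)%R then ((d - c) / `|a|)%:E else 0)%E.
Proof.
move=> a0; have [ap|an|/eqP] := ltgtP 0 a; last by rewrite eq_sym (negbTE a0).
- rewrite (_ : _ @^-1` _ = `](c - b) / a, (d - b) / a]%classic); last first.
    apply/seteqP; split => x /=; rewrite !in_itv/= ltr_pdivrMr// ler_pdivlMr// mulrC.
      by move=> /andP[h1 h2]; apply/andP; split; lra.
    by move=> /andP[h1 h2]; apply/andP; split; lra.
  rewrite lebesgue_measure_itv/= lte_fin ltr_pM2r ?invr_gt0// ltrD2r.
  by case: ifP => // _; rewrite gtr0_norm// -EFinB -mulrBl; congr (_ / _)%:E; ring.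
- rewrite (_ : _ @^-1` _ = `[(d - b) / a, (c - b) / a[%classic); last first.
    apply/seteqP; split => x /=; rewrite !in_itv/= ltr_ndivlMr// ler_ndivrMr// mulrC.
      by move=> /andP[h1 h2]; apply/andP; split; lra.
    by move=> /andP[h1 h2]; apply/andP; split; lra.
  rewrite lebesgue_measure_itv/= lte_fin ltr_nM2r ?invr_lt0// ltrD2r.
  case: ifP => // _; rewrite ltr0_norm// -EFinB -mulrBl; congr EFin.
  by rewrite invrN mulrN -mulNr; congr (_ / _); ring.
Qed.

(** The image measure scaled by [|a|] gives half-open intervals their length, and Lebesgue measure
    is the only measure that does. *)
Lemma lebesgue_measure_affine (a b : R) (A : set R) : a != 0 -> measurable A ->
  (leb A = `|a|%:E * leb ((fun x => a * x + b)%R @^-1` A))%E.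
Proof.
move=> a0 mA.
have mf : measurable_fun [set: measurableTypeR R] (fun x : measurableTypeR R => a * x + b : measurableTypeR R).
  by apply: measurable_funD => //; exact: measurable_funM.
have na : 0 <= `|a| by [].
pose pf : {measure set (measurableTypeR R) -> \bar R} :=
  measure_function_pushforward__canonical__measure_function_Measure leb mf.
suff : leb A = mscale (NngNum na) pf A by rewrite /mscale/= /pushforward.
apply: lebesgue_measure_unique => //= _ [[c d]] _ <-.
rewrite /mscale/= /pushforward/= preimage_affine_itv// lebesgue_measure_itv/= lte_fin.
case: ifP => _; last by rewrite mule0.
by rewrite -EFinM mulrCA divff ?mulr1// normr_eq0.
Qed.

Lemma integral_affine (a b : R) (f : R -> \bar R) : a != 0 ->
  measurable_fun [set: R] f -> (forall x, 0 <= f x)%E ->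
  (\int[leb]_x f x = `|a|%:E * \int[leb]_x f (a * x + b)%R)%E.
Proof.
move=> a0 mf f0.
have mf' : measurable_fun [set: measurableTypeR R] (fun x : measurableTypeR R => a * x + b : measurableTypeR R).
  by apply: measurable_funD => //; exact: measurable_funM.
have na : 0 <= `|a| by [].
pose pf : {measure set (measurableTypeR R) -> \bar R} :=
  measure_function_pushforward__canonical__measure_function_Measure leb mf'.
transitivity (\int[mscale (NngNum na) pf]_x f x)%E.
  apply: eq_measure_integral => A mA _.
  apply: etrans; first exact: (lebesgue_measure_affine b a0 mA).
  by rewrite /mscale/= /pushforward.
rewrite ge0_integral_mscale//=; congr (_ * _)%E.
by rewrite ge0_integral_pushforward//.
Qed.

End normal_density.

(** * Reflection invariance of the Gaussian law *)

Section standard_gaussian.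
Variable R : realType.

(** The identity transports the normal law from [measurableTypeR R] to [R], where tuples and
    products are taken. *)
Let idR : measurableTypeR R -> R := idfun.
HB.instance Definition _ := isMeasurableFun.Build _ _ _ _ idR (@measurable_id _ _ _).

Definition gauss1 : probability R R :=
  [the probability _ _ of distribution [the probability _ _ of @normal_prob R 0 1] idR].

Lemma normal_pdf01 (x : R) : normal_pdf 0 1 x = normal_peak 1 * expR (- x ^+ 2 / 2).
Proof. by rewrite normal_pdfE ?oner_neq0// /normal_fun subr0 expr1n. Qed.

Lemma integral_gauss1 (f : R -> \bar R) : measurable_fun [set: R] f -> (forall x, 0 <= f x)%E ->
  (\int[gauss1]_x f x = \int[lebesgue_measure]_x (f x * (normal_pdf 0 1 x)%:E))%E.
Proof.
move=> mf f0; rewrite -integral_normal_prob//.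
exact: (ge0_integral_distribution [the {mfun _ >-> _} of idR]).
Qed.

(** The exponential is the ratio of the normal densities at [a * y + b] and at [y]. The
    multidimensional invariances below reduce to this formula, applied one coordinate at a time. *)
Lemma gauss1_affine (a b : R) (f : R -> \bar R) : a != 0 ->
  measurable_fun [set: R] f -> (forall x, 0 <= f x)%E ->
  (\int[gauss1]_x f x =
   \int[gauss1]_y (f (a * y + b)%R * (`|a| * expR ((y ^+ 2 - (a * y + b) ^+ 2) / 2))%:E))%E.
Proof.
move=> a0 mf f0.
have maff : measurable_fun [set: R] (fun y : R => a * y + b).
  by apply: measurable_funD => //; exact: measurable_funM.
rewrite integral_gauss1// (integral_affine b a0)//; last 2 first.
  - by apply: emeasurable_funM => //; apply/measurable_EFinP; exact: measurable_normal_pdf.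
  - by move=> x; rewrite mule_ge0// lee_fin normal_pdf_ge0.
rewrite integral_gauss1; last 2 first.
  - apply: emeasurable_funM; first exact: measurableT_comp.
    apply/measurable_EFinP; apply: measurable_funM => //.
    apply: measurableT_comp => //; apply: measurable_funM => //.
    apply: measurable_funB; first exact: measurable_funX.
    exact: measurable_funX.
  - by move=> x; rewrite mule_ge0// lee_fin mulr_ge0// expR_ge0.
rewrite -ge0_integralZl_EFin//; last 2 first.
  - by move=> x _; rewrite mule_ge0// lee_fin normal_pdf_ge0.
  - apply: emeasurable_funM; first exact: measurableT_comp.
    apply/measurable_EFinP; apply: measurableT_comp => //; exact: measurable_normal_pdf.
apply: eq_integral => y _; rewrite muleCA -muleA -!EFinM; congr (_ * _%:E)%E.
rewrite !normal_pdf01 -!mulrA; congr (_ * _); rewrite mulrCA -expRD.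
by congr (_ * expR _); field.
Qed.

Definition gauss n : probability (n.-tuple R) R := pow gauss1 n.

Definition tshift n (a : 'I_n -> R) (t : n.-tuple R) : n.-tuple R := [tuple tnth t i + a i | i < n].
Definition tdot n (a : 'I_n -> R) (t : n.-tuple R) : R := \sum_i a i * tnth t i.

Lemma measurable_mktuple d (T : measurableType d) n (f : 'I_n -> T -> R) :
  (forall i, measurable_fun [set: T] (f i)) ->
  measurable_fun [set: T] (fun x => [tuple f i x | i < n]).
Proof.
move=> mf; apply/measurable_fun_tnthP => i.
by rewrite (_ : _ \o _ = f i)//; apply/funext => x /=; rewrite tnth_mktuple.
Qed.

Lemma measurable_tdot n (a : 'I_n -> R) : measurable_fun [set: n.-tuple R] (tdot a).
Proof.
apply: measurable_sum => i; apply: measurable_funM => //; exact: measurable_tnth.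
Qed.

Lemma tdot_tcons n (a : 'I_n.+1 -> R) x (t : n.-tuple R) :
  tdot a (tcons (x, t)) = a ord0 * x + tdot (fun i => a (lift ord0 i)) t.
Proof.
by rewrite /tdot big_ord_recl; congr (_ + _); apply: eq_bigr => i _; rewrite tnthS.
Qed.

Lemma tshift_tcons n (a : 'I_n.+1 -> R) x (t : n.-tuple R) :
  tshift a (tcons (x, t)) = tcons (x + a ord0, tshift (fun i => a (lift ord0 i)) t).
Proof.
apply: eq_from_tnth => i; rewrite tnth_mktuple; case: (unliftP ord0 i) => [j ->|->].
  by rewrite !tnthS tnth_mktuple.
by rewrite [RHS]/(tnth _ _).
Qed.

(** The Cameron-Martin formula, by induction on the number of coordinates. *)
Lemma gauss_shift n (a : 'I_n -> R) (f : n.-tuple R -> \bar R) :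
  measurable_fun [set: n.-tuple R] f -> (forall t, 0 <= f t)%E ->
  (\int[gauss n]_t f (tshift a t) =
   \int[gauss n]_t (f t * (expR (tdot a t - (\sum_i a i ^+ 2) / 2))%:E))%E.
Proof.
have mshift k (b : 'I_k -> R) : measurable_fun [set: k.-tuple R] (tshift b).
  by apply: measurable_mktuple => i; apply: measurable_funD => //; exact: measurable_tnth.
have mexp k (b : 'I_k -> R) c : measurable_fun [set: k.-tuple R]
    (fun t => (expR (tdot b t - c))%:E).
  apply/measurable_EFinP; apply: measurableT_comp => //.
  by apply: measurable_funB => //; exact: measurable_tdot.
elim: n a f => [|n IH] a f mf f0.
  apply: eq_integral => t _; rewrite /tdot !big_ord0 mul0r subrr expR0 mule1.
  by congr f; apply: eq_from_tnth => -[].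
pose a' i := a (lift ord0 i); pose s := (\sum_i a' i ^+ 2) / 2.
have m1 : measurable_fun [set: n.+1.-tuple R] (fun t => f (tshift a t)).
  exact: (measurableT_comp mf (mshift _ a)).
rewrite [LHS](integral_powS _ m1)//.
have m2 : measurable_fun [set: n.+1.-tuple R]
    (fun t => f t * (expR (tdot a t - (\sum_i a i ^+ 2) / 2))%:E)%E.
  exact: emeasurable_funM (mexp _ _ _).
have f2 t : (0 <= f t * (expR (tdot a t - (\sum_i a i ^+ 2) / 2))%:E)%E.
  by rewrite mule_ge0// lee_fin expR_ge0.
rewrite [RHS](integral_powS _ m2 f2).
(* [F] already carries the weights of all coordinates but the first; the induction hypothesis
   produces it, and the first shift remains for [gauss1_affine]. *)
pose F (t : n.+1.-tuple R) := (f t * (expR (tdot (fun i => if i == ord0 then 0 else a i) t - s))%:E)%E.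
have mF : measurable_fun [set: n.+1.-tuple R] F by exact: emeasurable_funM (mexp _ _ _).
have F0 t : (0 <= F t)%E by rewrite mule_ge0// lee_fin expR_ge0.
pose g x := (\int[gauss n]_t F (tcons (x, t)))%E.
have mg : measurable_fun [set: R] g by exact: measurable_integral_tcons.
have g0 x : (0 <= g x)%E by apply: integral_ge0.
have FE x t : F (tcons (x, t)) = (f (tcons (x, t)) * (expR (tdot a' t - s))%:E)%E.
  by rewrite /F tdot_tcons eqxx mul0r add0r.
transitivity (\int[gauss1]_x g (x + a ord0)%R)%E.
  apply: eq_integral => x _; rewrite /g.
  under eq_integral do rewrite tshift_tcons.
  have mfx : measurable_fun [set: n.-tuple R] (fun t => f (tcons (x + a ord0, t))).
    apply: (measurableT_comp mf); apply: (measurableT_comp (@measurable_tcons _ _ _)).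
    exact: pair1_measurable.
  rewrite (IH a' _ mfx (fun t => f0 _)).
  by apply: eq_integral => t _; rewrite FE.
have mga : measurable_fun [set: R] (fun x => g (x + a ord0)).
  apply: (measurableT_comp mg); exact: measurable_funD.
apply: (etrans (gauss1_affine (- a ord0) (oner_neq0 R) mga (fun=> g0 _))).
apply: eq_integral => x _; rewrite normr1 !mul1r subrK /g.
have mFx : measurable_fun [set: n.-tuple R] (fun t => F (tcons (x, t))).
  apply: (measurableT_comp mF); apply: (measurableT_comp (@measurable_tcons _ _ _)).
  exact: pair1_measurable.
have e0 : (0 <= (expR ((x ^+ 2 - (x - a ord0) ^+ 2) / 2))%:E)%E by rewrite lee_fin expR_ge0.
rewrite -(ge0_integralZr (gauss n) measurableT mFx (fun t _ => F0 _) e0).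
apply: eq_integral => t _; rewrite FE -muleA -EFinM -expRD; congr (_ * (expR _)%:E)%E.
rewrite tdot_tcons -/a' big_ord_recl /s.
by rewrite mulrDl -/a'; field.
Qed.

(** The map [refl z] on tuples, presented as a shift whose amount depends on [t] only through
    [tdot z t]; once that number is frozen, [gauss_shift] applies. *)
Definition trefl n (z : 'I_n -> R) (t : n.-tuple R) : n.-tuple R :=
  tshift (fun i => - (2 / (\sum_i z i ^+ 2) * tdot z t * z i)) t.

Lemma measurable_trefl n (z : 'I_n -> R) : measurable_fun [set: n.-tuple R] (trefl z).
Proof.
apply: measurable_mktuple => i; apply: measurable_funD; first exact: measurable_tnth.
apply: measurableT_comp => //; apply: measurable_funM => //; apply: measurable_funM => //.
exact: measurable_tdot.
Qed.

Lemma trefl_tcons n (z : 'I_n.+1 -> R) x (t : n.-tuple R) :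
  trefl z (tcons (x, t)) =
  let c := 2 / (\sum_i z i ^+ 2) * tdot z (tcons (x, t)) in
  tcons (x - c * z ord0, tshift (fun i => - (c * z (lift ord0 i))) t).
Proof. by rewrite /trefl tshift_tcons. Qed.

(** If the first entry of [z] vanishes, only the other coordinates move and induction applies.
    Otherwise, replacing the first coordinate by [y], the scalar product with [z], is an affine
    substitution for fixed [t]. In the new variables the reflection negates [y] and translates [t]
    by a vector depending on [y] alone. [gauss_shift] at fixed [y] removes the translation, and a
    second affine substitution returns to the first coordinate. *)
Lemma gauss_trefl n (z : 'I_n -> R) (f : n.-tuple R -> \bar R) :
  measurable_fun [set: n.-tuple R] f -> (forall t, 0 <= f t)%E ->
  (\int[gauss n]_t f (trefl z t) = \int[gauss n]_t f t)%E.
Proof.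
elim: n z f => [|n IH] z f mf f0.
  by apply: eq_integral => t _; congr f; apply: eq_from_tnth => -[].
pose z' i := z (lift ord0 i); pose q := \sum_i z' i ^+ 2.
have zE : \sum_i z i ^+ 2 = z ord0 ^+ 2 + q by rewrite big_ord_recl.
have mtc (x : R) : measurable_fun [set: n.-tuple R] (fun t => tcons (x, t)).
  apply: (measurableT_comp (@measurable_tcons _ _ _)); exact: pair1_measurable.
have mfr : measurable_fun [set: n.+1.-tuple R] (fun t => f (trefl z t)).
  exact: (measurableT_comp mf (measurable_trefl z)).
rewrite [LHS](integral_powS _ mfr (fun t => f0 _)).
have [z0|z0] := eqVneq (z ord0) 0.
  rewrite [RHS](integral_powS _ mf f0); apply: eq_integral => x _.
  rewrite -(IH z' _ (measurableT_comp mf (mtc x)) (fun t => f0 _)).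
  apply: eq_integral => t _; congr f; rewrite trefl_tcons/= z0 mulr0 subr0.
  by rewrite /trefl tdot_tcons zE z0 mul0r add0r expr0n add0r.
pose c := 2 / (z ord0 ^+ 2 + q).
have q0 : 0 <= q by apply: sumr_ge0 => i _; rewrite sqr_ge0.
have z2 : 0 < z ord0 ^+ 2 by rewrite exprn_even_gt0.
have cE : c * z ord0 ^+ 2 = 2 - c * q.
  by rewrite /c; field; rewrite gt_eqF// ltr_pwDl.
have measurable_tdot_snd (b : 'I_n -> R) : measurable_fun [set: R * n.-tuple R] (fun yt => tdot b yt.2).
  exact: measurableT_comp (measurable_tdot b) _.
(* [(x, t)] is reparametrized by [y := z . (x, t)], which the reflection maps to [- y] *)
pose K (yt : R * n.-tuple R) : \bar R := f (tcons ((- yt.1 - tdot z' yt.2) / z ord0, yt.2)).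
pose W (yt : R * n.-tuple R) : \bar R :=
  (`|(z ord0)^-1| * expR ((yt.1 ^+ 2 - ((yt.1 + tdot z' yt.2) / z ord0) ^+ 2) / 2))%:E.
pose J (yt : R * n.-tuple R) : \bar R :=
  (K (yt.1, tshift (fun i => - (c * yt.1 * z' i))%R yt.2) *
   (`|(z ord0)^-1| * expR ((yt.1 ^+ 2 - ((yt.1 - tdot z' yt.2) / z ord0) ^+ 2) / 2))%:E)%E.
have mK : measurable_fun [set: R * n.-tuple R] K.
  apply: (measurableT_comp mf); apply: (measurable_cons (g := snd)) => //.
  apply: measurable_funM => //; apply: measurable_funB => //.
  exact: measurableT_comp.
have mW : measurable_fun [set: R * n.-tuple R] W.
  apply/measurable_EFinP; apply: measurable_funM => //; apply: measurableT_comp => //.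
  apply: measurable_funM => //; apply: measurable_funB; first exact: measurable_funX.
  apply: measurable_funX; apply: measurable_funM => //; exact: measurable_funD.
have mJ : measurable_fun [set: R * n.-tuple R] J.
  apply: emeasurable_funM.
    apply: (measurableT_comp mK); apply: measurable_fun_pair => //.
    apply: measurable_mktuple => i; apply: measurable_funD.
      exact: (measurableT_comp (measurable_tnth i)).
    apply: measurableT_comp => //; apply: measurable_funM => //; exact: measurable_funM.
  apply/measurable_EFinP; apply: measurable_funM => //; apply: measurableT_comp => //.
  apply: measurable_funM => //; apply: measurable_funB; first exact: measurable_funX.
  apply: measurable_funX; apply: measurable_funM => //; exact: measurable_funB.
have K0 yt : (0 <= K yt)%E by exact: f0.
have W0 yt : (0 <= W yt)%E by rewrite lee_fin mulr_ge0// expR_ge0.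
have J0 yt : (0 <= J yt)%E by rewrite mule_ge0// lee_fin mulr_ge0// expR_ge0.
have zi0 : (z ord0)^-1 != 0 by rewrite invr_eq0.
pose fr (xt : R * n.-tuple R) := f (trefl z (tcons xt)).
have mfrc : measurable_fun [set: R * n.-tuple R] fr.
  exact: (measurableT_comp mfr (@measurable_tcons _ _ _)).
pose fc (xt : R * n.-tuple R) := f (tcons xt).
have mfc : measurable_fun [set: R * n.-tuple R] fc.
  exact: (measurableT_comp mf (@measurable_tcons _ _ _)).
transitivity (\int[gauss n]_t \int[gauss1]_x fr (x, t))%E.
  exact: (fubini_tonelli fr mfrc (fun _ => f0 _)).
transitivity (\int[gauss n]_t \int[gauss1]_y J (y, t))%E.
  apply: eq_integral => t _.
  have mfrt : measurable_fun [set: R] (fun x => fr (x, t)).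
    apply: (measurableT_comp mfrc); exact: pair2_measurable.
  apply: (etrans (gauss1_affine (- tdot z' t / z ord0) zi0 mfrt (fun _ => f0 _))).
  apply: eq_integral => y _.
  have xE : (z ord0)^-1 * y + - tdot z' t / z ord0 = (y - tdot z' t) / z ord0.
    by rewrite mulNr mulrBl mulrC.
  rewrite xE /J /K /fr trefl_tcons/= tdot_tcons zE -/z' -/c.
  have yE : z ord0 * ((y - tdot z' t) / z ord0) + tdot z' t = y.
    by rewrite mulrC divfK// subrK.
  rewrite yE; congr (f (tcons (_, _)) * _)%E.
  have -> : tdot z' (tshift (fun i => - (c * y * z' i)) t) = tdot z' t - c * y * q.
    rewrite /tdot /q mulr_sumr -sumrB; apply: eq_bigr => i _; rewrite tnth_mktuple.
    ring.
  apply: (mulIf z0); rewrite mulrBl !divfK//.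
  have -> : c * y * z ord0 * z ord0 = y * (c * z ord0 ^+ 2) by ring.
  by rewrite cE; ring.
transitivity (\int[gauss1]_y \int[gauss n]_t J (y, t))%E.
  exact/esym/(fubini_tonelli J mJ J0).
transitivity (\int[gauss1]_y \int[gauss n]_t (K (y, t) * W (y, t)))%E.
  apply: eq_integral => y _.
  (* [G] expresses the weight of [J] through the translated point, so that [J] is [G] after a shift.
     The Cameron-Martin factor then turns this weight into that of [W]. *)
  pose G t := (K (y, t) *
    (`|(z ord0)^-1| * expR ((y ^+ 2 - ((y - (tdot z' t + c * y * q)) / z ord0) ^+ 2) / 2))%:E)%E.
  have GJ t : J (y, t) = G (tshift (fun i => - (c * y * z' i)) t).
    have E : tdot z' (tshift (fun i => - (c * y * z' i)) t) + c * y * q = tdot z' t.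
      rewrite /tdot /q mulr_sumr -big_split; apply: eq_bigr => i _; rewrite tnth_mktuple.
      by rewrite /=; ring.
    by rewrite /G E.
  have mKy : measurable_fun [set: n.-tuple R] (fun t => K (y, t)).
    apply: (measurableT_comp mK); exact: pair1_measurable.
  have mG : measurable_fun [set: n.-tuple R] G.
    apply: emeasurable_funM => //.
    apply/measurable_EFinP; apply: measurable_funM => //; apply: measurableT_comp => //.
    apply: measurable_funM => //; apply: measurable_funB => //.
    apply: measurable_funX; apply: measurable_funM => //; apply: measurable_funB => //.
    apply: measurable_funD => //; exact: measurable_tdot.
  have G0 t : (0 <= G t)%E by rewrite mule_ge0// lee_fin mulr_ge0// expR_ge0.
  under eq_integral do rewrite GJ.
  rewrite (gauss_shift _ mG G0); apply: eq_integral => t _.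
  rewrite /G /W -muleA -EFinM; congr (_ * _%:E)%E.
  rewrite -[LHS]mulrA -expRD; congr (_ * expR _).
  have -> : tdot (fun i => - (c * y * z' i)) t = - (c * y * tdot z' t).
    by rewrite /tdot mulr_sumr -sumrN; apply: eq_bigr => i _; ring.
  have -> : \sum_i (- (c * y * z' i)) ^+ 2 = (c * y) ^+ 2 * q.
    by rewrite /q mulr_sumr; apply: eq_bigr => i _; ring.
  rewrite /=; set s := tdot z' t.
  have cq : c * q = 2 - c * z ord0 ^+ 2 by rewrite cE; ring.
  have -> : c * y * q = y * (2 - c * z ord0 ^+ 2) by rewrite -cq; ring.
  have -> : (c * y) ^+ 2 * q = c * y ^+ 2 * (2 - c * z ord0 ^+ 2) by rewrite -cq; ring.
  by field.
transitivity (\int[gauss n]_t \int[gauss1]_y (K (y, t) * W (y, t)))%E.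
  apply: (fubini_tonelli (fun yt => K yt * W yt)%E); first exact: emeasurable_funM.
  by move=> yt; rewrite mule_ge0.
rewrite [RHS](integral_powS _ mf f0).
transitivity (\int[gauss n]_t \int[gauss1]_x fc (x, t))%E; last first.
  exact/esym/(fubini_tonelli fc mfc (fun _ => f0 _)).
apply: eq_integral => t _.
have mft : measurable_fun [set: R] (fun x => fc (x, t)).
  apply: (measurableT_comp mfc); exact: pair2_measurable.
(* [K] evaluates [f] where the scalar product with [z] is [- y], hence the slope of opposite sign;
   the weights agree because the first coordinate enters them squared. *)
have nzi0 : - (z ord0)^-1 != 0 by rewrite oppr_eq0.
apply: esym; apply: (etrans (gauss1_affine (- tdot z' t / z ord0) nzi0 mft (fun _ => f0 _))).
apply: eq_integral => y _.
have xE : - (z ord0)^-1 * y + - tdot z' t / z ord0 = (- y - tdot z' t) / z ord0.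
  by rewrite !mulNr mulrBl mulNr mulrC.
have sE : ((- y - tdot z' t) / z ord0) ^+ 2 = ((y + tdot z' t) / z ord0) ^+ 2.
  by rewrite -opprD mulNr sqrrN.
by rewrite xE sE normrN.
Qed.

End standard_gaussian.

(** * Gaussian matrices *)

Section measurable_matrix.
Context d (T : measurableType d) (R : realType).

Definition mxmeasurable m n (F : T -> 'M[R]_(m, n)) :=
  forall i j, measurable_fun [set: T] (fun x => F x i j).

Lemma mxmeasurable_mul m n p (F : T -> 'M[R]_(m, n)) (G : T -> 'M[R]_(n, p)) :
  mxmeasurable F -> mxmeasurable G -> mxmeasurable (fun x => F x *m G x).
Proof.
move=> mF mG i j; under eq_fun do rewrite mxE.
by apply: measurable_sum => l; apply: measurable_funM; [exact: mF|exact: mG].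
Qed.

Lemma mxmeasurable_tr m n (F : T -> 'M[R]_(m, n)) :
  mxmeasurable F -> mxmeasurable (fun x => (F x)^T).
Proof. by move=> mF i j; under eq_fun do rewrite mxE; exact: mF. Qed.

Lemma measurable_det n (F : T -> 'M[R]_n) :
  mxmeasurable F -> measurable_fun [set: T] (fun x => \det (F x)).
Proof.
move=> mF; rewrite /determinant; apply: measurable_sum => s.
apply: measurable_funM => //; apply: measurable_prod => i _; exact: mF.
Qed.

Lemma mxmeasurable_adj n (F : T -> 'M[R]_n) :
  mxmeasurable F -> mxmeasurable (fun x => \adj (F x)).
Proof.
move=> mF i j; under eq_fun do rewrite mxE /cofactor.
apply: measurable_funM => //; apply: measurable_det => k l.
by under eq_fun do rewrite !mxE; exact: mF.
Qed.

Lemma measurable_nrm2 n (F : T -> 'cV[R]_n) :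
  mxmeasurable F -> measurable_fun [set: T] (fun x => nrm2 (F x)).
Proof. by move=> mF; apply: measurable_sum => i; apply: measurable_funX; exact: mF. Qed.

Lemma measurable_enorm n (F : T -> 'cV[R]_n) :
  mxmeasurable F -> measurable_fun [set: T] (fun x => enorm (F x)).
Proof.
move=> mF; rewrite /enorm; under eq_fun do rewrite -powR12_sqrt ?nrm2_ge0//.
by apply: (measurableT_comp (measurable_powR _)); exact: measurable_nrm2.
Qed.

Lemma measurable_nearker m n delta (F : T -> 'M[R]_(m, n)) (G : T -> 'cV[R]_n) :
  mxmeasurable F -> mxmeasurable G ->
  measurable_fun [set: T] (fun x => nearker delta (F x) (G x)).
Proof.
move=> mF mG.
have mgram : mxmeasurable (fun x => gram (F x)).
  by apply: mxmeasurable_mul => //; exact: mxmeasurable_tr.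
have mD : measurable_fun [set: T] (fun x => \det (gram (F x))) by exact: measurable_det.
apply: measurable_and.
  by apply: measurable_neg; apply: measurable_fun_eqr.
apply: measurable_fun_ler.
  apply: measurable_nrm2; apply: mxmeasurable_mul; first exact: mxmeasurable_tr.
  apply: mxmeasurable_mul; first exact: mxmeasurable_adj.
  exact: mxmeasurable_mul.
apply: measurable_funM; last exact: measurable_funX.
by apply: measurable_funM => //; exact: measurable_nrm2.
Qed.

End measurable_matrix.

(** * Events given by boolean functions *)

Section bool_sets.
Context d (T : measurableType d) (R : realType).

Lemma measurable_boolset (b : T -> bool) : measurable_fun [set: T] b -> measurable [set x | b x].
Proof.
move=> mb; rewrite (_ : [set x | b x] = b @^-1` [set true]); last by apply/seteqP; split.
by rewrite -[X in measurable X]setTI; exact: mb.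
Qed.

Lemma measurable_bool_natr (b : T -> bool) : measurable_fun [set: T] b ->
  measurable_fun [set: T] (fun x => (b x)%:R : R).
Proof.
move=> mb; rewrite (_ : (fun _ => _) = \1_[set x | b x]).
  by apply/measurable_indic; exact: measurable_boolset.
by apply/funext => x; rewrite indicE /= mem_setE.
Qed.

Lemma integral_bool (mu : {measure set T -> \bar R}) (b : T -> bool) : measurable_fun [set: T] b ->
  (\int[mu]_x ((b x)%:R)%:E = mu [set x | b x])%E.
Proof.
move=> mb; rewrite -[X in mu X]setIT -integral_indic//; last exact: measurable_boolset.
by apply: eq_integral => x _; rewrite indicE /= mem_setE.
Qed.

End bool_sets.

(** * Gaussian mass of hyperplanes and of cubes *)

Section gaussian_null.
Variable R : realType.

Lemma gauss1_null x : gauss1 R [set x] = 0%E.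
Proof.
have /null_content_dominatesP := @normal_prob_dominates R 0 1.
by apply => //; exact: lebesgue_measure_set1.
Qed.

(** If the first entry of [u] is nonzero, each line in the first direction meets the hyperplane in
    one point, and Tonelli concludes; otherwise the first coordinate is dropped. *)
Lemma gauss_tdot_null n (u : 'I_n -> R) : (exists i, u i != 0) ->
  gauss R n [set t | tdot u t == 0] = 0%E.
Proof.
elim: n u => [|n IH] u; first by case=> -[].
move=> [i ui].
have mb : measurable_fun [set: n.+1.-tuple R] (fun t => tdot u t == 0).
  by apply: measurable_fun_eqr => //; exact: measurable_tdot.
rewrite -integral_bool//.
pose F (t : n.+1.-tuple R) : \bar R := ((tdot u t == 0)%:R)%:E.
have mF : measurable_fun [set: n.+1.-tuple R] F.
  by apply/measurable_EFinP; exact: measurable_bool_natr.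
have F0 t : (0 <= F t)%E by rewrite lee_fin.
rewrite [LHS](integral_powS _ mF F0).
have [u0|u0] := eqVneq (u ord0) 0.
  have [j uj] : exists j, u (lift ord0 j) != 0.
    by case: (unliftP ord0 i) ui => [j ->|->]; [exists j|rewrite u0 eqxx].
  rewrite integral0_eq// => x _.
  rewrite /F; under eq_integral do rewrite tdot_tcons u0 mul0r add0r.
  rewrite integral_bool; first exact: (IH _ (ex_intro _ j uj)).
  by apply: measurable_fun_eqr => //; exact: measurable_tdot.
pose Fc (xt : R * n.-tuple R) := F (tcons xt).
have mFc : measurable_fun [set: R * n.-tuple R] Fc.
  exact: (measurableT_comp mF (@measurable_tcons _ _ _)).
transitivity (\int[gauss R n]_t \int[gauss1 R]_x Fc (x, t))%E.
  exact: (fubini_tonelli Fc mFc (fun _ => F0 _)).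
rewrite integral0_eq// => t _; set s := tdot (fun i => u (lift ord0 i)) t.
have E x : Fc (x, t) = ((x == - s / u ord0)%:R)%:E.
  rewrite /Fc /F tdot_tcons -/s; congr ((nat_of_bool _)%:R)%:E.
  by rewrite addr_eq0 mulrC (can2_eq (mulfK u0) (divfK u0)).
under eq_integral do rewrite E.
rewrite integral_bool; last by apply: measurable_fun_eqr.
have -> : [set x | x == - s / u ord0] = [set - s / u ord0].
  by apply/seteqP; split => x /= => [/eqP|->].
exact: gauss1_null.
Qed.

Lemma gauss1_itv_gt0 (a e : R) : 0 < e -> (0 < gauss1 R [set x | (`|x - a| <= e)%R])%E.
Proof.
move=> e0; have -> : [set x | (`|x - a| <= e)] = `[a - e, a + e]%classic.
  by apply/seteqP; split => x /=; rewrite in_itv/= ler_distl.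
pose c := normal_peak 1 * expR (- (`|a| + e) ^+ 2 / 2) : R.
have c0 : 0 < c by rewrite mulr_gt0 ?expR_gt0// normal_peak_gt0// oner_neq0.
apply: (@lt_le_trans _ _ (\int[lebesgue_measure]_(x in `[(a - e)%R, (a + e)%R]) c%:E)%E).
  rewrite integral_cst//= lebesgue_measure_itv/= lte_fin ltrD2l gtrN// -EFinB -EFinM lte_fin.
  by apply: mulr_gt0 => //; lra.
rewrite /gauss1/= /distribution /pushforward /normal_prob/=.
apply: ge0_le_integral => //=.
- by move=> x _; rewrite lee_fin ltW.
- apply/measurable_EFinP; apply: measurable_funTS; exact: measurable_normal_pdf.
- move=> x; rewrite in_itv/= => /andP[x1 x2]; rewrite lee_fin normal_pdf01 /c.
  rewrite ler_pM2l ?normal_peak_gt0 ?oner_neq0// ler_expR !mulNr lerN2 ler_pM2r//.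
  rewrite -(real_normK (num_real x)) ler_pXn2r ?nnegrE//; last by apply: addr_ge0 => //; exact: ltW.
  have := ler_norm a; have := ler_norm (- a); rewrite normrN => h1 h2.
  by rewrite ler_norml; apply/andP; split; lra.
Qed.

Lemma gauss_nbhs_gt0 n (h : 'I_n -> R) e : 0 < e ->
  (0 < gauss R n [set t | forall i, (`|tnth t i - h i| <= e)%R])%E.
Proof.
move=> e0; have := @pow_box _ _ _ (gauss1 R) n (fun i => [set x | `|x - h i| <= e]).
rewrite /box/= => ->.
  apply: (big_ind (fun x : \bar R => 0 < x)%E) => [|x y|i _].
  - by rewrite lte01.
  - exact: mule_gt0.
  - exact: gauss1_itv_gt0.
move=> i; apply: measurable_boolset; apply: measurable_fun_ler => //.
by apply: measurableT_comp => //; exact: measurable_funB.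
Qed.

End gaussian_null.

(** * Row-wise reflections and almost sure full rank *)

Section gaussian_matrix.
Variable R : realType.

Definition cv n (t : n.-tuple R) : 'cV[R]_n := \col_i tnth t i.
Definition mx m n (A : m.-tuple (n.-tuple R)) : 'M[R]_(m, n) := \matrix_(i, j) tnth (tnth A i) j.

Definition gaussmx m n : probability (m.-tuple (n.-tuple R)) R := pow (gauss R n) m.

Lemma mxmeasurable_cv n : mxmeasurable (@cv n).
Proof. by move=> i j; under eq_fun do rewrite mxE; exact: measurable_tnth. Qed.

Lemma mxmeasurable_mx m n : mxmeasurable (@mx m n).
Proof.
move=> i j; under eq_fun do rewrite mxE.
by apply: (measurableT_comp (measurable_tnth j)); exact: measurable_tnth.
Qed.

Lemma tdotE n (z : 'cV[R]_n) (t : n.-tuple R) : tdot (z^~ 0) t = dot z (cv t).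
Proof. by rewrite /dot mxE; apply: eq_bigr => i _; rewrite !mxE. Qed.

Lemma cv_trefl n (z : 'cV[R]_n) (t : n.-tuple R) : cv (trefl (z^~ 0) t) = refl z *m cv t.
Proof.
by apply/colP => i; rewrite mul_refl !mxE tnth_mktuple -tdotE /nrm2.
Qed.

Definition mxtrefl m n (z : 'cV[R]_n) : m.-tuple (n.-tuple R) -> m.-tuple (n.-tuple R) :=
  map_tuple (trefl (z^~ 0)).

Lemma mx_mxtrefl m n (z : 'cV[R]_n) (A : m.-tuple (n.-tuple R)) :
  mx (mxtrefl z A) = mx A *m refl z.
Proof.
apply/row_matrixP => i; rewrite row_mul; apply: trmx_inj.
rewrite trmx_mul tr_refl.
have rE (B : m.-tuple (n.-tuple R)) : (row i (mx B))^T = cv (tnth B i).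
  by apply/colP => j; rewrite !mxE.
by rewrite !rE tnth_map cv_trefl.
Qed.

Lemma measurable_mxtrefl m n (z : 'cV[R]_n) :
  measurable_fun [set: m.-tuple (n.-tuple R)] (@mxtrefl m n z).
Proof.
apply/measurable_fun_tnthP => i.
rewrite (_ : _ \o _ = trefl (z^~ 0) \o (fun t => tnth t i)).
  apply: measurableT_comp; [exact: measurable_trefl|exact: measurable_tnth].
by apply/funext => t /=; rewrite tnth_map.
Qed.

Lemma gauss_trefl_set n (z : 'I_n -> R) (A : set (n.-tuple R)) : measurable A ->
  gauss R n (trefl z @^-1` A) = gauss R n A.
Proof.
move=> mA.
have mpA : measurable (trefl z @^-1` A).
  by rewrite -[X in measurable X]setTI; exact: measurable_trefl.
rewrite -[in LHS](setIT (_ @^-1` _)) -[in RHS](setIT A) -!integral_indic//.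
rewrite -(@gauss_trefl _ _ z (fun t => (\1_A t)%:E))//.
by apply/measurable_EFinP; exact: measurable_indic.
Qed.

Lemma integral_invariant d (T : measurableType d) (P : probability T R) (phi : T -> T) :
  measurable_fun [set: T] phi -> (forall A, measurable A -> P (phi @^-1` A) = P A) ->
  forall f : T -> \bar R, measurable_fun [set: T] f -> (forall x, 0 <= f x)%E ->
  (\int[P]_x f (phi x) = \int[P]_x f x)%E.
Proof.
move=> mphi inv f mf f0.
rewrite -[LHS](ge0_integral_pushforward mphi P measurableT mf (fun x _ => f0 x)).
by apply: eq_measure_integral => A mA _; exact: inv.
Qed.

Lemma gaussmx_trefl m n (z : 'cV[R]_n) (f : m.-tuple (n.-tuple R) -> \bar R) :
  measurable_fun [set: m.-tuple (n.-tuple R)] f -> (forall x, 0 <= f x)%E ->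
  (\int[gaussmx m n]_A f (mxtrefl z A) = \int[gaussmx m n]_A f A)%E.
Proof.
move=> mf f0; apply: (integral_invariant (@measurable_mxtrefl m n z)) => //.
apply: (pow_map (measurable_trefl _)); exact: gauss_trefl_set.
Qed.

Lemma measurable_gram_det m n :
  measurable_fun [set: m.-tuple (n.-tuple R)] (fun A => \det (gram (mx A))).
Proof.
apply: measurable_det; apply: mxmeasurable_mul; first exact: mxmeasurable_mx.
apply: mxmeasurable_tr; exact: mxmeasurable_mx.
Qed.

(** Rows are added one at a time. While [m < n], a full-rank [A] has some kernel vector [x != 0],
    and a new row not orthogonal to [x] keeps the rows independent; the orthogonal rows form a null
    hyperplane. Since [A] is frozen by Tonelli, [x] need not depend measurably on it. *)
Lemma gaussmx_rank m n : (m <= n)%N ->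
  gaussmx m n [set A | \det (gram (mx A)) == 0] = 0%E.
Proof.
have mb k : measurable_fun [set: k.-tuple (n.-tuple R)] (fun A => \det (gram (mx A)) == 0).
  by apply: measurable_fun_eqr => //; exact: measurable_gram_det.
elim: m => [|m IH] mn.
  rewrite (_ : [set _ | _] = set0) ?measure0//; apply/seteqP; split => // A /=.
  by rewrite det_mx00 oner_eq0.
rewrite -(integral_bool _ (mb m.+1)).
pose F (A : m.+1.-tuple (n.-tuple R)) : \bar R := ((\det (gram (mx A)) == 0)%:R)%:E.
have mF : measurable_fun [set: m.+1.-tuple (n.-tuple R)] F.
  by apply/measurable_EFinP; exact: measurable_bool_natr (mb _).
have F0 A : (0 <= F A)%E by rewrite lee_fin.
rewrite [LHS](integral_powS _ mF F0).
pose Fc (rA : n.-tuple R * m.-tuple (n.-tuple R)) := F (tcons rA).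
have mFc : measurable_fun [set: n.-tuple R * m.-tuple (n.-tuple R)] Fc.
  exact: (measurableT_comp mF (@measurable_tcons _ _ _)).
transitivity (\int[gaussmx m n]_A \int[gauss R n]_r Fc (r, A))%E.
  exact: (fubini_tonelli Fc mFc (fun _ => F0 _)).
apply/eqP; rewrite eq_le integral_ge0 ?andbT; last by move=> A _; apply: integral_ge0 => r _; exact: F0.
rewrite -(IH (ltnW mn)) -(integral_bool _ (mb m)).
have mFcA A : measurable_fun [set: n.-tuple R] (fun r => Fc (r, A)).
  by apply: (measurableT_comp mFc); exact: pair2_measurable.
apply: ge0_le_integral => //.
- by move=> A _; apply: integral_ge0 => r _; exact: F0.
- exact: (measurable_fun_fubini_tonelli_G Fc mFc (fun _ => F0 _)).
- by apply/measurable_EFinP; exact: measurable_bool_natr (mb _).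
move=> A _; case: eqP => [_|/eqP D].
  rewrite -[leRHS]mule1 -[X in (_ * X)%E](probability_setT (gauss R n)) -integral_cst//.
  by apply: ge0_le_integral => // r _; rewrite lee_fin; case: (_ == _).
have fA := row_free_gram D.
have [x x0 Ax] : exists2 x : 'cV[R]_n, x != 0 & mx A *m x = 0.
  by apply: exists_ker; rewrite (eqP fA).
have null : gauss R n [set t | tdot (x^~ 0) t == 0] = 0%E.
  apply: gauss_tdot_null.
  apply/existsP; apply: contraNT x0 => /existsPn h.
  by apply/eqP/colP => i; have := h i; rewrite negbK mxE => /eqP.
rewrite -[leRHS]/(0%E) -null -integral_bool; last first.
  by apply: measurable_fun_eqr => //; exact: measurable_tdot.
apply: ge0_le_integral => //; first by move=> r _; exact: F0.
  apply/measurable_EFinP; apply: measurable_bool_natr.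
  by apply: measurable_fun_eqr => //; exact: measurable_tdot.
move=> r _; rewrite /Fc /F lee_fin ler_nat.
case: (boolP (tdot _ _ == 0)) => [_|rx]; first by case: (_ == _).
suff -> : \det (gram (mx (tcons (r, A)))) == 0 = false by [].
apply/negbTE; apply: gram_row_free.
have -> : mx (tcons (r, A)) = col_mx (cv r)^T (mx A) :> 'M[R]_(1 + m, n).
  apply/matrixP => i j; rewrite mxE; case: (split_ordP i) => i' ->.
    by rewrite col_mxEu !mxE [i']ord1 (_ : lshift m 0 = ord0)//; apply/val_inj.
  by rewrite col_mxEd mxE (_ : rshift 1 i' = lift ord0 i') ?tnthS//; apply/val_inj.
apply: (@row_free_ker _ (1 + m)) => u; rewrite -[u]hsubmxK mul_row_col => h.
have h2 : lsubmx u = 0.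
  have := congr1 (mulmx^~ x) h.
  rewrite /= mul0mx mulmxDl -!mulmxA Ax mulmx0 addr0.
  rewrite [(cv r)^T *m x]mx11_scalar -/(dot _ _) dotC -tdotE mul_mx_scalar => /eqP.
  by rewrite scaler_eq0 (negbTE rx) => /eqP.
move: h; rewrite h2 mul0mx add0r => h1.
have -> : rsubmx u = 0.
  by move: fA => /row_free_inj inj; apply: inj; rewrite h1 mul0mx.
by rewrite row_mx0.
Qed.

End gaussian_matrix.

(** * The kernel of a Gaussian matrix avoids rare cones *)

Section random_kernel.
Variable R : realType.

Lemma enorm_mul_isometry k n (V : 'M[R]_(n, k)) (a : 'cV[R]_k) : V^T *m V = 1%:M ->
  enorm (V *m a) = enorm a.
Proof. by move=> VV; rewrite /enorm !nrm2E -!/(dot _ _) dot_mull mulmxA VV mul1mx. Qed.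

(** A net of the sphere of [R^k] is carried into the kernel by an isometry, so [C] depends on [eta]
    only. *)
Lemma kernel_sphere_net (eta : R) : 0 < eta -> exists C : nat, forall m k n (A : 'M[R]_(m, n)),
  row_free A -> (m + k = n)%N ->
  exists s : seq 'cV[R]_n, [/\ (size s <= C ^ k)%N,
    forall b, b \in s -> A *m b = 0 /\ enorm b = 1 &
    forall x : 'cV[R]_n, A *m x = 0 -> enorm x = 1 -> exists2 b, b \in s & enorm (x - b) <= eta].
Proof.
move=> /sphere_net[C netC]; exists C => m k n A fA mk.
have [V [VV AV xV]] := ker_orthobasis fA mk.
have [s [ss s1 snet]] := netC k.
exists [seq V *m b | b <- s]; split; first by rewrite size_map.
  by move=> _ /mapP[b bs ->]; rewrite mulmxA AV mul0mx enorm_mul_isometry// s1.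
move=> x Ax x1; have xE := xV x Ax.
have [b bs xb] : exists2 b, b \in s & enorm (V^T *m x - b) <= eta.
  by apply: snet; rewrite -(enorm_mul_isometry _ VV) -xE.
exists (V *m b); first exact: map_f.
by rewrite {1}xE -mulmxBr enorm_mul_isometry.
Qed.

(** Comparing [g] with the vector of the same length along [w] avoids normalizing [g]. The zero
    vector belongs to every cone with [eta >= 0]. *)
Definition incone n (eta : R) (w g : 'cV[R]_n) : bool := enorm (g - enorm g *: w) <= eta * enorm g.

Lemma incone_refl n eta (z w g : 'cV[R]_n) :
  incone eta (refl z *m w) (refl z *m g) = incone eta w g.
Proof. by rewrite /incone enorm_refl scalemxAr -mulmxBr enorm_refl. Qed.

(** The term [delta] is paid twice: once to move from [g] to [h], and once to rescale [h] to the
    length of [g], since their lengths differ by at most [enorm (g - h)]. *)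
Lemma incone_near n (delta eta : R) (g h b : 'cV[R]_n) : h != 0 ->
  enorm (g - h) <= delta * enorm g -> enorm ((enorm h)^-1 *: h - b) <= eta ->
  incone (2 * delta + eta) b g.
Proof.
move=> h0 gh hb; set u := (enorm h)^-1 *: h in hb.
have hu : h = enorm h *: u by rewrite /u scalerA divff ?scale1r// enorm_eq0.
have u1 : enorm u = 1 by exact: enorm_unit.
have hg : enorm (h - enorm g *: u) <= enorm (g - h).
  rewrite {1}hu -scalerBl enormZ u1 mulr1 ler_norml; apply/andP; split.
    rewrite lerNl opprB lerBlDr -[X in enorm X <= _](subrK h).
    exact: enormD.
  rewrite lerBlDr addrC -[X in enorm X <= _](subKr g) (le_trans (enormD _ _))//.
  by rewrite enormN.
rewrite /incone.
have -> : g - enorm g *: b = (g - h) + ((h - enorm g *: u) + enorm g *: (u - b)).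
  by rewrite scalerBr !subrKA.
apply: le_trans (enormD _ _) _.
have := enormD (h - enorm g *: u) (enorm g *: (u - b)).
rewrite enormZ (ger0_norm (enorm_ge0 g)) => h1.
have : enorm g * enorm (u - b) <= enorm g * eta by rewrite ler_wpM2l// enorm_ge0.
by lra.
Qed.

(** * Averaging the conditional laws over the matrix *)

Section fixed_dimensions.
Variables (m n : nat) (delta : R).
Local Notation Tn := (n.-tuple R).
Local Notation Tmn := (m.-tuple (n.-tuple R)).

(** The zero vector satisfies [nearker] trivially but has no direction, so it is excluded. *)
Definition nearb (A : Tmn) (t : Tn) : bool := (cv t != 0) && nearker delta (mx A) (cv t).

Lemma measurable_cv_neq0 : measurable_fun [set: Tn] (fun t => cv t != 0).
Proof.
under eq_fun do rewrite -nrm2_eq0; apply: measurable_neg; apply: measurable_fun_eqr => //.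
apply: measurable_nrm2; exact: mxmeasurable_cv.
Qed.

Lemma measurable_nearb2 : measurable_fun [set: Tmn * Tn] (fun At => nearb At.1 At.2).
Proof.
apply: measurable_and.
  exact: (measurableT_comp measurable_cv_neq0 measurable_snd).
apply: measurable_nearker => i j.
  exact: (measurableT_comp (@mxmeasurable_mx R m n i j) measurable_fst).
exact: (measurableT_comp (@mxmeasurable_cv R n i j) measurable_snd).
Qed.

Lemma measurable_nearb (A : Tmn) : measurable_fun [set: Tn] (nearb A).
Proof.
exact: (measurableT_comp measurable_nearb2 (pair1_measurable A)).
Qed.

Lemma nearb_refl (A : Tmn) (z : 'cV[R]_n) (t : Tn) :
  nearb (mxtrefl z A) (trefl (z^~ 0) t) = nearb A t.
Proof.
rewrite /nearb mx_mxtrefl cv_trefl nearker_refl; congr (_ && _).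
by rewrite -!enorm_eq0 enorm_refl.
Qed.

Definition nearmass (A : Tmn) : \bar R := gauss R n [set t | nearb A t].

Lemma nearmass_le1 A : (nearmass A <= 1)%E.
Proof. by apply: probability_le1; apply: measurable_boolset; exact: measurable_nearb. Qed.

Lemma nearmass_fin A : nearmass A \is a fin_num.
Proof. by rewrite ge0_fin_numE ?measure_ge0// (le_lt_trans (nearmass_le1 A))// ltry. Qed.

Lemma measurable_mass (B : Tmn * Tn -> bool) : measurable_fun [set: Tmn * Tn] B ->
  measurable_fun [set: Tmn] (fun A => gauss R n [set t | B (A, t)]).
Proof.
move=> mB.
have mF : measurable_fun [set: Tmn * Tn] (fun At => ((B At)%:R)%:E : \bar R).
  by apply/measurable_EFinP; exact: measurable_bool_natr.
have := measurable_fun_fubini_tonelli_F (m2 := gauss R n) _ mF (fun _ => _).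
rewrite /fubini_F; under eq_fun => A.
  rewrite integral_bool; last exact: (measurableT_comp mB (pair1_measurable A)).
  over.
by apply=> x; rewrite lee_fin.
Qed.

Lemma measurable_nearmass : measurable_fun [set: Tmn] nearmass.
Proof. exact: (measurable_mass measurable_nearb2). Qed.

Lemma nearmass_refl A (z : 'cV[R]_n) : nearmass (mxtrefl z A) = nearmass A.
Proof.
rewrite /nearmass -(gauss_trefl_set (z^~ 0)); last first.
  by apply: measurable_boolset; exact: measurable_nearb.
by congr (gauss R n _); apply/seteqP; split => t /=; rewrite nearb_refl.
Qed.

Lemma nearmass_gt0 A k : 0 < delta -> (m + k = n)%N -> (0 < k)%N ->
  \det (gram (mx A)) != 0 -> (0 < nearmass A)%E.
Proof.
move=> d0 mk k0 D.
have fA := row_free_gram D.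
have [x x0 Ax] : exists2 x : 'cV[R]_n, x != 0 & mx A *m x = 0.
  by apply: exists_ker; rewrite (eqP fA) -[X in (_ < X)%N]mk -[X in (X < _)%N]addn0 ltn_add2l.
have [e e0 near] := nearker_nbhs d0 D Ax x0.
have [i xi] : exists i, x i 0 != 0.
  apply/existsP; apply: contraNT x0 => /existsPn h.
  by apply/eqP/colP => i; have := h i; rewrite negbK mxE => /eqP.
(* The second bound keeps coordinate [i] away from 0, so that the whole cube avoids the zero
   vector. *)
pose e' := Num.min e (`|x i 0| / 2).
have e'0 : 0 < e' by rewrite lt_min e0 divr_gt0// normr_gt0.
apply: lt_le_trans (gauss_nbhs_gt0 (x^~ 0) e'0) _.
apply: le_measure; rewrite ?inE.
- apply: (@measurable_box _ _ n (fun i => [set y | `|y - x i 0| <= e'])) => j.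
  apply: measurable_boolset; apply: measurable_fun_ler => //.
  by apply: measurableT_comp => //; exact: measurable_funB.
- by apply: measurable_boolset; exact: measurable_nearb.
move=> t /= tx; rewrite /nearb; apply/andP; split.
  apply/eqP => /colP/(_ i); rewrite !mxE => ti.
  have := tx i; rewrite ti sub0r normrN le_min => /andP[_].
  by rewrite leNgt ltr_pdivrMr// ltr_pMr ?normr_gt0// ltr1n.
apply: near => j; rewrite mxE; apply: le_trans (tx j) _.
by rewrite ge_min lexx.
Qed.

(* By rotation invariance, averaging over [A] the conditional law of a Gaussian vector given
   that it is near [ker A] gives back a law with the same directions as the Gaussian law. *)
Definition weight (A : Tmn) : R := (fine (nearmass A)) `^ (-1).

Lemma measurable_weight : measurable_fun [set: Tmn] weight.
Proof.
apply: (measurableT_comp (measurable_powR _)).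
exact: (measurableT_comp (fine_measurable measurableT) measurable_nearmass).
Qed.

Lemma weight_ge0 A : 0 <= weight A. Proof. exact: powR_ge0. Qed.

(** Only an inequality, because a zero mass gives product 0. *)
Lemma nearmass_weight_le1 A : (nearmass A * (weight A)%:E <= 1)%E.
Proof.
rewrite -(fineK (nearmass_fin A)) /weight.
have c0 : 0 <= fine (nearmass A) by rewrite fine_ge0// measure_ge0.
rewrite powR_inv1// -EFinM lee_fin.
have [->|c1] := eqVneq (fine (nearmass A)) 0; first by rewrite mul0r.
by rewrite divff.
Qed.

Lemma nearmass_weight A : (0 < nearmass A)%E -> (nearmass A * (weight A)%:E = 1)%E.
Proof.
move=> A0; rewrite -(fineK (nearmass_fin A)) /weight.
have c0 : 0 < fine (nearmass A).
  by rewrite fine_gt0// A0/= (le_lt_trans (nearmass_le1 A))// ltry.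
by rewrite powR_inv1 ?ltW// -EFinM divff// gt_eqF.
Qed.

(** The density, relative to the Gaussian law, of the mixture over [A] of the Gaussian laws
    conditioned on being near the kernel of [A]. *)
Definition dirdens (t : Tn) : \bar R :=
  (\int[gaussmx R m n]_A (((nearb A t)%:R * weight A)%R)%:E)%E.

Let integrand (At : Tmn * Tn) : \bar R := (((nearb At.1 At.2)%:R * weight At.1)%R)%:E.

Let mintegrand : measurable_fun [set: Tmn * Tn] integrand.
Proof.
apply/measurable_EFinP; apply: measurable_funM.
  by apply: measurable_bool_natr; exact: measurable_nearb2.
exact: (measurableT_comp measurable_weight measurable_fst).
Qed.

Let integrand0 At : (0 <= integrand At)%E.
Proof. by rewrite lee_fin mulr_ge0// weight_ge0. Qed.

Lemma dirdens0 t : cv t = 0 -> dirdens t = 0%E.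
Proof.
move=> t0; apply: integral0_eq => A _.
by rewrite /nearb t0 eqxx mul0r.
Qed.

(** A dilation followed by a reflection takes [u] to [v]. Nearness ignores the dilation, and
    reflecting the matrix as well changes neither its law nor [nearmass]. *)
Lemma dirdens_const (u v : Tn) : cv u != 0 -> cv v != 0 -> dirdens u = dirdens v.
Proof.
move=> u0 v0; pose s := enorm (cv v) / enorm (cv u).
have s0 : s != 0 by rewrite mulf_neq0 ?invr_eq0 ?enorm_eq0.
pose z := s *: cv u - cv v.
have zu : refl z *m (s *: cv u) = cv v.
  apply: refl_swap; rewrite nrm2Z /s expr_div_n !sqr_enorm divfK//.
  by rewrite nrm2_eq0.
pose F (A : Tmn) : \bar R := (((nearb A v)%:R * weight A)%R)%:E.
have mF : measurable_fun [set: Tmn] F.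
  exact: (measurableT_comp mintegrand (pair2_measurable v)).
have F0 A : (0 <= F A)%E by exact: (integrand0 (A, v)).
rewrite [RHS]/dirdens -[RHS](gaussmx_trefl z mF F0); apply: eq_integral => A _.
rewrite /F /weight nearmass_refl; congr ((nat_of_bool _)%:R * _)%:E.
rewrite /nearb u0 v0/= mx_mxtrefl -zu nearker_refl nearkerZ//.
Qed.

(** Being constant off the origin, a null set as [n > 0], the function is bounded by its own
    Gaussian average, and Tonelli identifies that average with the mean over [A] of mass times
    weight. *)
Lemma dirdens_le1 t : (0 < n)%N -> (dirdens t <= 1)%E.
Proof.
move=> n0; have [t0|t0] := eqVneq (cv t) 0; first by rewrite dirdens0.
have neq0 : gauss R n [set t | cv t != 0] = 1%E.
  have mb := measurable_cv_neq0.
  apply/eqP; rewrite eq_le probability_le1//=; last exact: measurable_boolset.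
  pose u (i : 'I_n) : R := (i == Ordinal n0)%:R.
  have := @gauss_tdot_null R n u.
  have mt : measurable_fun [set: Tn] (fun t => tdot u t == 0).
    by apply: measurable_fun_eqr => //; exact: measurable_tdot.
  move=> /(_ (ex_intro _ (Ordinal n0) _)) h.
  have {}h : gauss R n [set t | tdot u t == 0] = 0%E by apply: h; rewrite /u eqxx oner_eq0.
  rewrite -[leLHS](@adde0 _ 1%E) -oppe0 -h -(probability_setC (gauss R n)); last exact: measurable_boolset.
  apply: le_measure; rewrite ?inE.
  - by apply: measurableC; exact: measurable_boolset.
  - exact: measurable_boolset.
  move=> t' /= tu; apply/eqP => t'0; apply: tu; rewrite /tdot big1// => i _.
  by move/colP: t'0 => /(_ i); rewrite !mxE => ->; rewrite mulr0.
have -> : dirdens t = (\int[gauss R n]_t' dirdens t')%E.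
  rewrite -[LHS]mule1 -neq0 -integral_bool; last exact: measurable_cv_neq0.
  rewrite -ge0_integralZl//.
  - apply: eq_integral => t' _; have [t'0|t'0] := eqVneq (cv t') 0.
      by rewrite mule0 dirdens0.
    by rewrite mule1; exact: dirdens_const.
  - by apply/measurable_EFinP; apply: measurable_bool_natr; exact: measurable_cv_neq0.
  - by apply: integral_ge0 => A _; exact: (integrand0 (A, t)).
rewrite -(fubini_tonelli integrand mintegrand integrand0).
rewrite -(probability_setT (gaussmx R m n)) -[leRHS]mul1e -integral_cst//.
apply: ge0_le_integral => //.
- by move=> A _; apply: integral_ge0 => t' _; exact: integrand0.
- exact: (measurable_fun_fubini_tonelli_F integrand mintegrand integrand0).
move=> A _; rewrite /integrand/=; under eq_integral do rewrite EFinM.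
rewrite ge0_integralZr//.
- by rewrite integral_bool ?nearmass_weight_le1//; exact: measurable_nearb.
- by apply/measurable_EFinP; apply: measurable_bool_natr; exact: measurable_nearb.
- by rewrite lee_fin weight_ge0.
Qed.

(** * From rare Gaussian vectors to rare kernels *)

Variable Bad : Tn -> bool.
Hypothesis mBad : measurable_fun [set: Tn] Bad.

Definition badmass (A : Tmn) : \bar R := gauss R n [set t | Bad t && nearb A t].

Lemma measurable_Bad_nearb2 : measurable_fun [set: Tmn * Tn] (fun At => Bad At.2 && nearb At.1 At.2).
Proof.
apply: measurable_and; last exact: measurable_nearb2.
exact: (measurableT_comp mBad measurable_snd).
Qed.

Lemma measurable_Bad_nearb A : measurable_fun [set: Tn] (fun t => Bad t && nearb A t).
Proof. by apply: measurable_and => //; exact: measurable_nearb. Qed.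

Lemma integral_badmass_weight : (0 < n)%N ->
  (\int[gaussmx R m n]_A (badmass A * (weight A)%:E) <= gauss R n [set t | Bad t])%E.
Proof.
move=> n0.
pose F (At : Tmn * Tn) : \bar R := (((Bad At.2 && nearb At.1 At.2)%:R * weight At.1)%R)%:E.
have mF : measurable_fun [set: Tmn * Tn] F.
  apply/measurable_EFinP; apply: measurable_funM.
    by apply: measurable_bool_natr; exact: measurable_Bad_nearb2.
  exact: (measurableT_comp measurable_weight measurable_fst).
have F0 At : (0 <= F At)%E by rewrite lee_fin mulr_ge0// weight_ge0.
have -> : (\int[gaussmx R m n]_A (badmass A * (weight A)%:E) =
    \int[gaussmx R m n]_A \int[gauss R n]_t F (A, t))%E.
  apply: eq_integral => A _; rewrite /F/=; under [RHS]eq_integral do rewrite EFinM.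
  rewrite ge0_integralZr//.
  - by rewrite integral_bool//; exact: measurable_Bad_nearb.
  - by apply/measurable_EFinP; apply: measurable_bool_natr; exact: measurable_Bad_nearb.
  - by rewrite lee_fin weight_ge0.
rewrite (fubini_tonelli F mF F0) -integral_bool//.
apply: ge0_le_integral => //.
- by move=> t _; apply: integral_ge0 => A _; exact: F0.
- exact: (measurable_fun_fubini_tonelli_G F mF F0).
- by apply/measurable_EFinP; exact: measurable_bool_natr.
move=> t _; rewrite /F/=; case: (Bad t) => /=.
  exact: dirdens_le1.
by rewrite integral0_eq// => A _; rewrite mul0r.
Qed.

(** The conditional probability of [Bad] given [nearb A] is less than [1 / N], with the quotient
    cleared; full rank is required in addition. *)
Definition goodb (N : nat) (A : Tmn) : bool :=
  (\det (gram (mx A)) != 0) && (badmass A * N%:R%:E < nearmass A)%E.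

Lemma measurable_goodb N : measurable_fun [set: Tmn] (goodb N).
Proof.
apply: measurable_and.
  by apply: measurable_neg; apply: measurable_fun_eqr => //; exact: measurable_gram_det.
apply: measurable_fun_lte; last exact: measurable_nearmass.
apply: emeasurable_funM => //; exact: (measurable_mass measurable_Bad_nearb2).
Qed.

(** Markov's inequality: off the null set of rank-deficient matrices, failure means that [N] times
    the conditional mass of [Bad] is at least 1. *)
Lemma goodb_prob N k : 0 < delta -> (m + k = n)%N -> (0 < k)%N ->
  (gaussmx R m n [set A | ~~ goodb N A] <= N%:R%:E * gauss R n [set t | Bad t])%E.
Proof.
move=> d0 mk k0.
have mdet : measurable_fun [set: Tmn] (fun A => \det (gram (mx A)) == 0).
  by apply: measurable_fun_eqr => //; exact: measurable_gram_det.
pose b2 (A : Tmn) := ~~ goodb N A && (\det (gram (mx A)) != 0).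
have mb2 : measurable_fun [set: Tmn] b2.
  apply: measurable_and; first by apply: measurable_neg; exact: measurable_goodb.
  exact: measurable_neg.
have mbad : measurable_fun [set: Tmn] badmass := measurable_mass measurable_Bad_nearb2.
have mbw : measurable_fun [set: Tmn] (fun A => badmass A * (weight A)%:E)%E.
  by apply: emeasurable_funM => //; apply/measurable_EFinP; exact: measurable_weight.
have bw0 A : (0 <= badmass A * (weight A)%:E)%E.
  by rewrite mule_ge0 ?measure_ge0// lee_fin weight_ge0.
apply: (@le_trans _ _ (gaussmx R m n [set A | b2 A])).
  rewrite -[leRHS]adde0 -(@gaussmx_rank R m n); last by rewrite -mk leq_addr.
  apply: le_trans (measureU2 _ _ _); rewrite ?inE; try exact: measurable_boolset.
  apply: le_measure; rewrite ?inE.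
  - by apply: measurable_boolset; apply: measurable_neg; exact: measurable_goodb.
  - by apply: measurableU; exact: measurable_boolset.
  by move=> A /= gA; rewrite /b2 gA; case: (_ == 0); [right|left].
rewrite -integral_bool//.
apply: (@le_trans _ _ (\int[gaussmx R m n]_A (N%:R%:E * (badmass A * (weight A)%:E)))%E); last first.
  rewrite ge0_integralZl//.
  apply: lee_wpmul2l; first by rewrite lee_fin.
  by apply: integral_badmass_weight; rewrite -mk ltn_addl.
apply: ge0_le_integral => //.
- by apply/measurable_EFinP; exact: measurable_bool_natr.
- exact: emeasurable_funM.
move=> A _; rewrite /b2 /goodb; case: (boolP (_ == 0)) => [_|D]; first by rewrite andbF mule_ge0.
rewrite andbT -leNgt; case: (boolP (nearmass A <= _)%E) => [le|_]; last exact: mule_ge0.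
have A0 := nearmass_gt0 d0 mk k0 D.
rewrite -[leLHS](nearmass_weight A0) muleCA muleA muleC.
by rewrite [leRHS]muleC lee_wpmul2l// lee_fin weight_ge0.
Qed.

Lemma goodb_cone N (eta : R) (A : Tmn) (w : 'cV[R]_n) (s : seq 'cV[R]_n) :
  0 < delta -> delta < 1 -> goodb N A ->
  (size s <= N)%N -> (forall b, b \in s -> mx A *m b = 0 /\ enorm b = 1) ->
  (forall x : 'cV[R]_n, mx A *m x = 0 -> enorm x = 1 -> exists2 b, b \in s & enorm (x - b) <= eta) ->
  mx A *m w = 0 -> enorm w = 1 ->
  exists2 t : Tn, incone (2 * delta + eta) w (cv t) & ~~ Bad t.
Proof.
move=> d0 d1 /andP[D lt] sN sker net Aw w1.
apply: contrapT => h.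
pose cone b (t : Tn) := nearb A t && incone (2 * delta + eta) b (cv t).
have mcone b : measurable_fun [set: Tn] (cone b).
  apply: measurable_and; first exact: measurable_nearb.
  have men : measurable_fun [set: Tn] (fun t => enorm (cv t)).
    by apply: measurable_enorm; exact: mxmeasurable_cv.
  apply: measurable_fun_ler; last exact: measurable_funM.
  apply: measurable_enorm => i j; under eq_fun do rewrite !mxE.
  by apply: measurable_funB; [exact: measurable_tnth|exact: measurable_funM].
(* The reflection along [w - b], a kernel vector, exchanges the two cones and preserves nearness to
   the kernel. *)
have coneE b : b \in s -> gauss R n [set t | cone b t] = gauss R n [set t | cone w t].
  move=> bs; have [Ab b1] := sker _ bs; pose z := w - b.
  have Az : mx A *m z = 0 by rewrite mulmxBr Aw Ab subrr.
  have zw : refl z *m w = b by apply: refl_swap; rewrite -!sqr_enorm w1 b1.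
  rewrite -(gauss_trefl_set (z^~ 0)); last exact: measurable_boolset.
  congr (gauss R n _); apply/funext => t /=; congr is_true; rewrite /cone /nearb cv_trefl -zw.
  rewrite incone_refl -!enorm_eq0 enorm_refl; congr (_ && _ && _).
  by rewrite -{1}(mul_refl_ker Az) nearker_refl.
have mhas r : measurable_fun [set: Tn] (fun t => has (cone^~ t) r).
  elim: r => [|c r' IH]; first exact: measurable_cst.
  exact: (measurable_or (mcone c) IH).
have hasE (r : seq 'cV[R]_n) : {subset r <= s} ->
    (gauss R n [set t | has (cone^~ t) r] <= (size r)%:R%:E * gauss R n [set t | cone w t])%E.
  elim: r => [|c r' IH] rs.
    by rewrite mul0e (_ : [set _ | _] = set0) ?measure0//; apply/seteqP; split.
  apply: (@le_trans _ _ (gauss R n ([set t | cone c t] `|` [set t | has (cone^~ t) r']))).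
    apply: le_measure; rewrite ?inE.
    - by apply: measurable_boolset; exact: mhas.
    - by apply: measurableU; apply: measurable_boolset.
    by move=> t'' /= /orP[|]; [left|right].
  have U : (gauss R n ([set t | cone c t] `|` [set t | has (cone^~ t) r']) <=
      gauss R n [set t | cone c t] + gauss R n [set t | has (cone^~ t) r'])%E.
    by apply: measureU2; apply: measurable_boolset.
  apply: le_trans U _.
  rewrite (coneE c (rs _ (mem_head c r'))) [size _]/= -natr1 EFinD ge0_muleDl ?lee_fin// mul1e addeC.
  by apply: leeD => //; apply: IH => c' cr; apply: rs; rewrite inE cr orbT.
have : (nearmass A <= N%:R%:E * badmass A)%E.
  apply: (@le_trans _ _ (gauss R n [set t | has (cone^~ t) s])).
    apply: le_measure; rewrite ?inE.
    - by apply: measurable_boolset; exact: measurable_nearb.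
    - by apply: measurable_boolset; exact: mhas.
    move=> t /= nt; have /andP[t0 /(nearkerP (ltW d0))[g Ag gt]] := nt.
    (* Here [delta < 1] is used: a nonzero vector is then not within [delta] times its length of the
       origin, so its projection on the kernel has a direction. *)
    have g0 : g != 0.
      apply/eqP => g0; move: gt; rewrite g0 subr0 leNgt => /negP; apply.
      by rewrite gtr_pMl// enorm_gt0.
    have [b bs gb] : exists2 b, b \in s & enorm ((enorm g)^-1 *: g - b) <= eta.
      by apply: net; [rewrite -scalemxAr Ag scaler0|exact: enorm_unit].
    by apply/hasP; exists b => //; rewrite /cone nt/=; exact: (incone_near g0).
  apply: le_trans (hasE s _) _ => //.
  apply: lee_pmul; rewrite ?lee_fin ?measure_ge0 ?ler_nat//.
  apply: le_measure; rewrite ?inE.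
  - exact: measurable_boolset.
  - by apply: measurable_boolset; exact: measurable_Bad_nearb.
  move=> t /= /andP[nt wt]; rewrite nt andbT; apply: contrapT => /negP bt.
  by apply: h; exists t => //; apply/negP.
by rewrite muleC leNgt lt.
Qed.

End fixed_dimensions.

Lemma gaussmx_kernel_cones (eta : R) : 0 < eta -> exists C : nat, forall m k n,
  (m + k = n)%N -> (0 < k)%N -> forall Bad : n.-tuple R -> bool, measurable_fun [set: n.-tuple R] Bad ->
  exists2 E : set (m.-tuple (n.-tuple R)), measurable E /\
    (gaussmx R m n (~` E) <= (C ^ k)%:R%:E * gauss R n [set t | Bad t])%E &
  forall A, E A -> forall w : 'cV[R]_n, mx A *m w = 0 -> enorm w = 1 ->
    exists2 t : n.-tuple R, incone eta w (cv t) & ~~ Bad t.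
Proof.
move=> eta0; have [C net] := kernel_sphere_net (divr_gt0 eta0 (ltr0n R 2)).
exists C => m k n mk k0 Bad mBad.
(* With net mesh [eta / 2], the bound [eta / 4] gives [2 * delta + eta / 2 <= eta]; the bound
   [1 / 2] ensures [delta < 1]. *)
pose delta := Num.min (eta / 4) (1 / 2).
have d0 : 0 < delta by rewrite lt_min !divr_gt0.
have d1 : delta < 1 by rewrite gt_min; apply/orP; right; lra.
exists [set A | goodb delta Bad (C ^ k) A].
  split; first by apply: measurable_boolset; exact: measurable_goodb.
  rewrite (_ : ~` _ = [set A | ~~ goodb delta Bad (C ^ k) A]); last first.
    by apply/seteqP; split => A /= /negP.
  exact: (goodb_prob mBad _ d0 mk k0).
move=> A /= gA w Aw w1; have /andP[D _] := gA.
have [s [ss sker snet]] := net _ _ _ _ (row_free_gram D) mk.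
have [t tw bt] := goodb_cone mBad d0 d1 gA ss sker snet Aw w1.
exists t => //; apply: le_trans tw _; rewrite ler_wpM2r ?enorm_ge0//.
have : delta <= eta / 4 by rewrite ge_min lexx.
lra.
Qed.

End random_kernel.

(** * Chernoff's bound for Gaussian sums *)

Section chernoff.
Variable R : realType.

Lemma integral_pow_prod d (T : measurableType d) (mu : probability T R) n (h : T -> R) :
  measurable_fun [set: T] h -> (forall x, 0 <= h x) ->
  (\int[pow mu n]_t (\prod_(i < n) h (tnth t i))%:E = \prod_(i < n) \int[mu]_x (h x)%:E)%E.
Proof.
move=> mh h0.
have mprod k : measurable_fun [set: k.-tuple T] (fun t => (\prod_(i < k) h (tnth t i))%:E).
  apply/measurable_EFinP; apply: measurable_prod => i _.
  exact: (measurableT_comp mh (measurable_tnth i)).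
have prod0 k (t : k.-tuple T) : (0 <= (\prod_(i < k) h (tnth t i))%:E)%E.
  by rewrite lee_fin prodr_ge0.
elim: n => [|n IH].
  by rewrite (integral_pow0 _ (mprod 0)) !big_ord0.
rewrite [LHS](integral_powS _ (mprod n.+1) (prod0 n.+1)) [RHS]big_ord_recl.
transitivity (\int[mu]_x ((h x)%:E * \int[pow mu n]_t (\prod_(i < n) h (tnth t i))%:E))%E.
  apply: eq_integral => x _; rewrite -(ge0_integralZl_EFin _ measurableT (fun t _ => prod0 n t) (mprod n) (h0 x)).
  apply: eq_integral => t _; rewrite -EFinM big_ord_recl; congr (_ * _)%:E.
  by apply: eq_bigr => i _; rewrite tnthS.
rewrite IH ge0_integralZr//.
- exact/measurable_EFinP.
- by move=> x _; rewrite lee_fin.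
- by rewrite -IH; apply: integral_ge0 => t _; exact: prod0.
Qed.

(** The indicator of a nonnegative sum is at most the exponential of [l] times the sum, and the
    integral of that exponential factorizes. *)
Lemma gauss_sum_ge0 n (f : R -> R) (l r : R) : measurable_fun [set: R] f -> 0 <= l ->
  (\int[gauss1 R]_x (expR (l * f x))%:E <= r%:E)%E ->
  (gauss R n [set t | (0 <= \sum_(i < n) f (tnth t i))%R] <= (r ^+ n)%:E)%E.
Proof.
move=> mf l0 fr.
have mh : measurable_fun [set: R] (fun x => expR (l * f x)).
  by apply: measurableT_comp => //; exact: measurable_funM.
have mb : measurable_fun [set: n.-tuple R] (fun t => 0 <= \sum_(i < n) f (tnth t i)).
  apply: measurable_fun_ler => //; apply: measurable_sum => i.
  exact: (measurableT_comp mf (measurable_tnth i)).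
have mp : measurable_fun [set: n.-tuple R] (fun t => (\prod_(i < n) expR (l * f (tnth t i)))%:E).
  apply/measurable_EFinP; apply: measurable_prod => i _.
  exact: (measurableT_comp mh (measurable_tnth i)).
rewrite -(integral_bool (gauss R n) mb).
apply: (@le_trans _ _ (\int[gauss R n]_t (\prod_(i < n) expR (l * f (tnth t i)))%:E)%E).
  apply: ge0_le_integral => //.
  - by apply/measurable_EFinP; exact: measurable_bool_natr.
  - move=> t _; rewrite lee_fin; case: (boolP (0 <= _)) => [s0|_]; last first.
      by apply: prodr_ge0 => i _; exact: expR_ge0.
    rewrite -expR_sum -mulr_sumr -expR0 ler_expR mulr_ge0//.
rewrite (integral_pow_prod (gauss1 R) n mh); last by move=> x; exact: expR_ge0.
have i0 : (0 <= \int[gauss1 R]_x (expR (l * f x))%:E)%E.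
  by apply: integral_ge0 => x _; rewrite lee_fin expR_ge0.
rewrite -(fineK (x := \int[gauss1 R]_x (expR (l * f x))%:E)%E); last first.
  by rewrite ge0_fin_numE// (le_lt_trans fr)// ltry.
have r0 : 0 <= r by rewrite -lee_fin (le_trans i0).
rewrite prodEFin prodr_const card_ord lee_fin lerXn2r ?nnegrE ?fine_ge0//.
by rewrite -lee_fin fineK// ge0_fin_numE// (le_lt_trans fr)// ltry.
Qed.

(** A common integrable majorant for functions of quadratic growth; the exponent stays below the
    [x ^+ 2 / 2] of the normal density. *)
Definition gexp (x : R) : R := expR (x ^+ 2 / 4).

Lemma measurable_gexp : measurable_fun [set: R] gexp.
Proof. by apply: measurableT_comp => //; apply: measurable_funM => //; exact: measurable_funX. Qed.

Lemma integrable_gexp : (gauss1 R).-integrable setT (EFin \o gexp).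
Proof.
have mg : measurable_fun [set: R] (EFin \o gexp) by apply/measurable_EFinP; exact: measurable_gexp.
apply/integrableP; split => //.
under eq_integral do rewrite gee0_abs ?lee_fin ?expR_ge0//.
rewrite integral_gauss1//; last by move=> x; rewrite lee_fin expR_ge0.
(* Against the standard density, [gexp] is a multiple of the density of variance 2. *)
pose s := Num.sqrt 2 : R.
have s2 : s ^+ 2 = 2 by rewrite sqr_sqrtr.
have s0 : s != 0 by rewrite sqrtr_eq0 -ltNge.
rewrite [ltLHS](_ : _ = \int[lebesgue_measure]_x ((normal_peak 1 / normal_peak s)%:E * (normal_pdf 0 s x)%:E))%E; last first.
  apply: eq_integral => x _; rewrite -!EFinM normal_pdf01 normal_pdfE// /normal_fun subr0 s2 /gexp; congr EFin.
  rewrite [RHS]mulrA divfK ?gt_eqF ?normal_peak_gt0// [LHS]mulrCA -expRD; congr (_ * expR _).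
  by rewrite -mulr_natr; field.
rewrite ge0_integralZl_EFin//.
- by rewrite integral_normal_pdf mule1 ltry.
- by move=> x _; rewrite lee_fin normal_pdf_ge0.
- by apply/measurable_EFinP; exact: measurable_normal_pdf.
- by rewrite divr_ge0// ltW// normal_peak_gt0// oner_neq0.
Qed.

Lemma gauss_integrable (f : R -> R) K : measurable_fun [set: R] f ->
  (forall x, `|f x| <= K * gexp x) -> (gauss1 R).-integrable setT (EFin \o f).
Proof.
move=> mf fK; apply: (le_integrable measurableT _ _ (integrableZl measurableT K integrable_gexp)).
  exact/measurable_EFinP.
move=> x _; rewrite lee_fin; apply: le_trans (fK x) _; exact: ler_norm.
Qed.

Lemma Rintegral_gauss1_cst (c : R) : \int[gauss1 R]_x c = c.
Proof.
rewrite Rintegral_cst// [X in fine X](_ : _ = 1%E) ?mulr1//; exact: probability_setT.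
Qed.

Lemma gexp_ge (x : R) : 1 + x ^+ 2 <= 4 * gexp x.
Proof.
have := expR_ge1Dx (x ^+ 2 / 4); rewrite -/(gexp x); have := sqr_ge0 x; lra.
Qed.

(** For either sign, [exp y - 1 - y <= y (exp y - 1) <= y^2 exp |y|]. *)
Lemma expR_le_quadratic (y : R) : expR y <= 1 + y + y ^+ 2 * expR `|y|.
Proof.
have e1 : expR y - 1 <= y * expR y.
  have := expR_ge1Dx (- y); rewrite expRN => h.
  have e0 := expR_gt0 y.
  have : (1 - y) * expR y <= 1 by rewrite -ler_pdivlMr// mul1r.
  lra.
have e2 := expR_ge1Dx y.
have [y0|y0] := leP 0 y.
  by rewrite (ger0_norm y0); have := expR_gt0 y; nra.
have : 1 <= expR `|y| by rewrite -expR0 ler_expR.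
nra.
Qed.

(** A second-order expansion at [l = 0]: the linear term [l * m] is negative and beats the quadratic
    one for small [l]. *)
Lemma gauss_laplace (f : R -> R) K : measurable_fun [set: R] f -> 0 < K ->
  (forall x, `|f x| <= K * (1 + x ^+ 2)) -> \int[gauss1 R]_x f x < 0 ->
  exists l r, [/\ 0 < l, 0 < r, r < 1 & (\int[gauss1 R]_x (expR (l * f x))%:E <= r%:E)%E].
Proof.
move=> mf K0 fK m0; set m := \int[_]_x f x in m0.
have If : (gauss1 R).-integrable setT (EFin \o f).
  apply: (@gauss_integrable _ (K * 4)) => // x; apply: le_trans (fK x) _.
  by rewrite -mulrA ler_pM2l// gexp_ge.
(* The constant in [1 + x^2 <= 16 exp (x^2 / 16)], whose square leaves room for another
   [exp (x^2 / 8)] under [gexp]. *)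
have [B B16] : exists B : R, B = 16 by exists 16.
pose M := \int[gauss1 R]_x gexp x.
pose C := K ^+ 2 * B ^+ 2 * expR (1 / 8) * M + 1.
have M0 : 0 <= M by apply: Rintegral_ge0 => x _; exact: expR_ge0.
have C0 : 0 < C.
  apply: ltr_wpDl => //; apply: mulr_ge0 => //; apply: mulr_ge0; last exact: expR_ge0.
  by apply: mulr_ge0 => //; exact: sqr_ge0.
(* The first bound gives [|l f x| <= (1 + x^2) / 8], so that the remainder is dominated by [gexp];
   the second makes the quadratic term at most half of the linear gain. *)
pose l := Num.min (1 / (8 * K)) (- m / (2 * C)).
have l0 : 0 < l by rewrite lt_min !divr_gt0// ?mulr_gt0// oppr_gt0.
have lK : l * K <= 1 / 8.
  have : l <= 1 / (8 * K) by rewrite ge_min lexx.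
  by rewrite ler_pdivlMr ?mulr_gt0// => h; lra.
have lC : l * C <= - m / 2.
  have : l <= - m / (2 * C) by rewrite ge_min lexx orbT.
  by rewrite ler_pdivlMr ?mulr_gt0// => h; lra.
(* The maximum with [1 / 2] keeps [r] positive, so that its logarithm can be taken later. *)
exists l, (Num.max (1 / 2) (1 + l * m / 2)).
split=> //; first by rewrite lt_max divr_gt0.
  rewrite gt_max; apply/andP; split; first by lra.
  have lm : l * m < 0 by rewrite pmulr_rlt0.
  lra.
have ptw x : expR (l * f x) <= 1 + l * f x + l ^+ 2 * (K ^+ 2 * B ^+ 2 * expR (1 / 8)) * gexp x.
  have n1 : `|l * f x| <= (1 + x ^+ 2) / 8.
    rewrite normrM (gtr0_norm l0); have := fK x; have := sqr_ge0 x => x0 h.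
    have : l * `|f x| <= l * (K * (1 + x ^+ 2)) by rewrite ler_pM2l.
    nra.
  have n2 : f x ^+ 2 <= K ^+ 2 * (B ^+ 2 * expR (x ^+ 2 / 8)).
    rewrite -(real_normK (num_real (f x))).
    apply: (@le_trans _ _ ((K * (B * expR (x ^+ 2 / 16))) ^+ 2)); last first.
      rewrite !exprMn -expRM_natl.
      have -> : 2%:R * (x ^+ 2 / 16) = x ^+ 2 / 8 by field.
      by [].
    have B0 : 0 <= B by rewrite B16.
    rewrite ler_pXn2r ?nnegrE ?mulr_ge0 ?expR_ge0 ?(ltW K0)//.
    apply: le_trans (fK x) _; rewrite ler_pM2l//.
    by rewrite B16; have := expR_ge1Dx (x ^+ 2 / 16); have := sqr_ge0 x; lra.
  have ee : expR (x ^+ 2 / 8) * expR ((1 + x ^+ 2) / 8) = expR (1 / 8) * gexp x.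
    by rewrite /gexp -!expRD; congr expR; field.
  have n3 : f x ^+ 2 * expR `|l * f x| <= K ^+ 2 * B ^+ 2 * expR (1 / 8) * gexp x.
    apply: (@le_trans _ _ (K ^+ 2 * (B ^+ 2 * expR (x ^+ 2 / 8)) * expR ((1 + x ^+ 2) / 8))).
      by apply: ler_pM; rewrite ?sqr_ge0 ?expR_ge0// ler_expR.
    by rewrite -[leRHS]mulrA -ee !mulrA.
  apply: le_trans (expR_le_quadratic _) _; rewrite lerD2l exprMn -[leLHS]mulrA -[leRHS]mulrA.
  exact: (ler_wpM2l (sqr_ge0 l)).
have I1 : (gauss1 R).-integrable setT (EFin \o cst (1 : R)).
  apply: (@gauss_integrable _ 4) => // x; rewrite normr1; apply: le_trans (gexp_ge x).
  by rewrite lerDl sqr_ge0.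
have Ilf : (gauss1 R).-integrable setT (EFin \o (fun x => l * f x)).
  exact: (integrableZl measurableT l If).
pose c := l ^+ 2 * (K ^+ 2 * B ^+ 2 * expR (1 / 8)).
have Ig : (gauss1 R).-integrable setT (EFin \o (fun x => c * gexp x)).
  exact: (integrableZl measurableT c integrable_gexp).
have I2 : (gauss1 R).-integrable setT (EFin \o (fun x => 1 + l * f x)) by exact: (integrableD measurableT I1 Ilf).
have I3 : (gauss1 R).-integrable setT (EFin \o (fun x => 1 + l * f x + c * gexp x)).
  exact: (integrableD measurableT I2 Ig).
apply: (@le_trans _ _ (\int[gauss1 R]_x (1 + l * f x + c * gexp x)%:E)%E).
  apply: ge0_le_integral => //.
  - by apply/measurable_EFinP; apply: measurableT_comp => //; exact: measurable_funM.
  - exact: (measurable_int _ I3).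
  - by move=> x _; rewrite lee_fin; exact: ptw.
rewrite -[leLHS]fineK; last exact: integrable_fin_num.
rewrite lee_fin -/(Rintegral _ _ _) (RintegralD _ I2 Ig)// (RintegralD _ I1 Ilf)//.
rewrite Rintegral_gauss1_cst RintegralZl// RintegralZl//; last exact: integrable_gexp.
rewrite -/m -/M le_max; apply/orP; right.
have -> : c * M = l ^+ 2 * (C - 1) by rewrite /c /C; ring.
nra.
Qed.

End chernoff.

(** * Sums of p-th powers on supports *)

Section lp_cones.
Variable R : realType.
Implicit Types p rho t eps eta : R.

(** A ratio [s] in (0, 1] satisfies [s <= s^p]; adding this for [a / (a + b)] and [b / (a + b)]
    gives the claim. *)
Lemma powRD_le p (a b : R) : 0 < p -> p <= 1 -> 0 <= a -> 0 <= b ->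
  (a + b) `^ p <= a `^ p + b `^ p.
Proof.
move=> p0 p1 a0 b0.
have [->|a1] := eqVneq a 0; first by rewrite add0r powR0 ?gt_eqF// add0r.
have [->|b1] := eqVneq b 0; first by rewrite addr0 powR0 ?gt_eqF// addr0.
have {a1}a0 : 0 < a by rewrite lt_neqAle eq_sym a1.
have {b1}b0 : 0 < b by rewrite lt_neqAle eq_sym b1.
have s0 : 0 < a + b by rewrite addr_gt0.
have h c : 0 < c -> c <= a + b -> c / (a + b) * (a + b) `^ p <= c `^ p.
  move=> c0 cs; rewrite -[X in _ <= X `^ _](divfK (lt0r_neq0 s0)).
  rewrite (powRM _ (divr_ge0 (ltW c0) (ltW s0)) (ltW s0)) ler_pM2r ?powR_gt0//.
  apply: ger1_powR => //.
  by rewrite divr_gt0// ler_pdivrMr// mul1r.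
have := lerD (h a a0 _) (h b b0 _); rewrite -mulrDl -mulrDl divff ?gt_eqF// mul1r.
by apply; rewrite ?lerDl ?lerDr ltW.
Qed.

Lemma powR_normB_le p (a b : R) : 0 < p -> p <= 1 -> `|a| `^ p <= `|b| `^ p + `|a - b| `^ p.
Proof.
move=> p0 p1; apply: le_trans (powRD_le p0 p1 _ _) => //.
apply: ge0_ler_powR; rewrite ?nnegrE ?addr_ge0 ?(ltW p0)//.
by rewrite addrC -{1}(subrK b a) ler_normD.
Qed.

(** Split at [eps^(1/p)]: below it the power is at most [eps], above it the ratio to the split point
    exceeds 1 and its square dominates its power. This converts Euclidean closeness into closeness
    of p-th power sums, uniformly in the dimension. *)
Lemma powR_le_sqr p eps : 0 < p -> p <= 1 -> 0 < eps ->
  exists2 C, 0 < C & forall x : R, `|x| `^ p <= eps + C * x ^+ 2.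
Proof.
move=> p0 p1 e0; pose y := eps `^ (p^-1).
have y0 : 0 < y by exact: powR_gt0.
have yp : y `^ p = eps by rewrite /y -powRrM mulVf ?gt_eqF// powRr1// ltW.
exists (eps / y ^+ 2); first by rewrite divr_gt0// exprn_gt0.
move=> x; have [xy|yx] := leP `|x| y.
  apply: (@le_trans _ _ eps); last by rewrite lerDl mulr_ge0 ?sqr_ge0// divr_ge0 ?sqr_ge0 ?ltW.
  by rewrite -yp; apply: ge0_ler_powR; rewrite ?nnegrE ?(ltW p0) ?(ltW y0).
apply: (@le_trans _ _ (eps / y ^+ 2 * x ^+ 2)); last by rewrite lerDr ltW.
have u1 : 1 <= `|x| / y by rewrite ler_pdivlMr// mul1r ltW.
rewrite -(real_normK (num_real x)) -mulrA [_^-1 * _]mulrC -exprVn -exprMn.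
have -> : `|x| `^ p = eps * (`|x| / y) `^ p.
  by rewrite -yp -powRM ?(ltW y0)// ?(le_trans ler01)// mulrC divfK// gt_eqF.
rewrite ler_pM2l//; apply: le_trans (ler1_powR u1 p1) _.
by rewrite expr2 ler_peMr// (le_trans ler01).
Qed.

(** The sum over [S] minus the sum off [S] is twice the sum over [S] minus the total. On [S] each
    power is at most [t] plus its excess over [t], and there are at most [rho * n] terms. *)
Definition sep p rho t eps (x : R) : R :=
  2 * rho * t + 2 * Num.max (`|x| `^ p - t) 0 - `|x| `^ p + eps * (1 + x ^+ 2).

Lemma measurable_sep p rho t eps : measurable_fun [set: R] (sep p rho t eps).
Proof.
have mp : measurable_fun [set: R] (fun x => `|x| `^ p).
  exact: (measurableT_comp (measurable_powR p)).
apply: measurable_funD.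
  apply: measurable_funB => //; apply: measurable_funD => //; apply: measurable_funM => //.
  apply: measurable_maxr => //; exact: measurable_funB.
apply: measurable_funM => //; apply: measurable_funD => //; exact: measurable_funX.
Qed.

Lemma powR_norm_le p (x : R) : 0 < p -> p <= 1 -> `|x| `^ p <= 1 + x ^+ 2.
Proof.
move=> p0 p1; have [x1|x1] := leP `|x| 1.
  apply: (@le_trans _ _ 1); last by rewrite lerDl sqr_ge0.
  by have := @ge0_ler_powR R p (ltW p0) `|x| 1; rewrite powR1; apply; rewrite ?nnegrE.
apply: le_trans (ler1_powR (ltW x1) p1) _.
rewrite -(real_normK (num_real x)); set y := `|x| in x1 *; nra.
Qed.

Lemma sep_le p rho t eps : 0 < p -> p <= 1 -> 0 <= t -> 0 <= eps ->
  exists2 K, 0 < K & forall x, `|sep p rho t eps x| <= K * (1 + x ^+ 2).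
Proof.
move=> p0 p1 t0 e0; exists (2 * `|rho| * t + 3 + eps).
  by rewrite ltr_wpDr// ltr_wpDl// !mulr_ge0.
move=> x; have := powR_norm_le x p0 p1; have := powR_ge0 `|x| p; have := sqr_ge0 x.
rewrite /sep; set y := `|x| `^ p; set u := x ^+ 2 => u0 y0 yu.
have mx0 : 0 <= Num.max (y - t) 0 by rewrite le_max lexx orbT.
have mx1 : Num.max (y - t) 0 <= y by rewrite ge_max y0 andbT gerBl.
have := ler_norm rho; have := ler_norm (- rho); rewrite normrN => r1 r2.
have r3 : rho * t <= `|rho| * t by rewrite ler_wpM2r.
have r4 : - (`|rho| * t) <= rho * t by rewrite -mulNr ler_wpM2r// lerNl.
have r5 : 0 <= `|rho| * t * u by apply: mulr_ge0 => //; exact: mulr_ge0.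
have r6 : 0 <= eps * u by exact: mulr_ge0.
have r7 : 0 <= `|rho| * t by exact: mulr_ge0.
rewrite ler_norml; apply/andP; split; nra.
Qed.

(** With [eta ^ 2 = eps / C], the p-th powers of the entries of [g - v], where [v] is [w] rescaled
    to the length of [g], add up to at most the slack in [sep]. By the p-triangle inequality the
    violation for [v] thus passes to [g] up to that slack. No constant depends on [n]. *)
Lemma cone_sep p rho t eps : 0 < p -> p <= 1 -> 0 <= t -> 0 < eps ->
  exists2 eta, 0 < eta & forall n (w : 'cV[R]_n) (S : {set 'I_n}) (g : n.-tuple R),
    #|S|%:R <= rho * n%:R ->
    \sum_(i in ~: S) `|w i 0| `^ p <= \sum_(i in S) `|w i 0| `^ p ->
    incone eta w (cv g) -> 0 <= \sum_i sep p rho t eps (tnth g i).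
Proof.
move=> p0 p1 t0 e0; have [C C0 CE] := powR_le_sqr p0 p1 e0.
exists (Num.sqrt (eps / C)); first by rewrite sqrtr_gt0 divr_gt0.
move=> n w S g Sn wS; rewrite /incone le_enorm ?mulr_ge0 ?sqrtr_ge0 ?enorm_ge0//.
rewrite exprMn sqr_sqrtr; last by rewrite ltW// divr_gt0.
rewrite sqr_enorm.
set v := enorm (cv g) *: w => near.
have vS : \sum_(i in ~: S) `|v i 0| `^ p <= \sum_(i in S) `|v i 0| `^ p.
  have vE i : `|v i 0| `^ p = enorm (cv g) `^ p * `|w i 0| `^ p.
    by rewrite mxE normrM (ger0_norm (enorm_ge0 _)) powRM ?enorm_ge0.
  under eq_bigr do rewrite vE; under [leRHS]eq_bigr do rewrite vE.
  by rewrite -!mulr_sumr ler_wpM2l// powR_ge0.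
pose dd i := `|tnth g i - v i 0| `^ p.
have dsum : \sum_i dd i <= \sum_i (eps * (1 + tnth g i ^+ 2)).
  apply: (@le_trans _ _ (\sum_(i < n) (eps + C * (tnth g i - v i 0) ^+ 2))).
    by apply: ler_sum => i _; exact: CE.
  rewrite big_split/= -mulr_sumr; under [leRHS]eq_bigr do rewrite mulrDr mulr1.
  rewrite [leRHS]big_split/= -mulr_sumr lerD2l.
  have gvE : \sum_i (tnth g i - v i 0) ^+ 2 = nrm2 (cv g - v).
    by apply: eq_bigr => i _; rewrite !mxE.
  have gE : nrm2 (cv g) = \sum_i tnth g i ^+ 2 by apply: eq_bigr => i _; rewrite mxE.
  by move: near; rewrite gvE -gE mulrAC ler_pdivlMr// mulrC.
have gS : \sum_(i in ~: S) `|tnth g i| `^ p <= \sum_(i in S) `|tnth g i| `^ p + \sum_i dd i.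
  have ddE : \sum_i dd i = \sum_(i in S) dd i + \sum_(i in ~: S) dd i.
    by rewrite (bigID (mem S))/=; congr (_ + _); apply: eq_bigl => i; rewrite finset.in_setC.
  have h1 : \sum_(i in ~: S) `|tnth g i| `^ p <=
      \sum_(i in ~: S) `|v i 0| `^ p + \sum_(i in ~: S) dd i.
    by rewrite -big_split/=; apply: ler_sum => i _; exact: powR_normB_le.
  have h2 : \sum_(i in S) `|v i 0| `^ p <= \sum_(i in S) `|tnth g i| `^ p + \sum_(i in S) dd i.
    by rewrite -big_split/=; apply: ler_sum => i _; rewrite /dd distrC; exact: powR_normB_le.
  lra.
pose mxi i := Num.max (`|tnth g i| `^ p - t) 0.
have topS : \sum_(i in S) `|tnth g i| `^ p <= rho * n%:R * t + \sum_i mxi i.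
  apply: (@le_trans _ _ (\sum_(i in S) (t + mxi i))).
    by apply: ler_sum => i _; rewrite -lerBlDl /mxi le_max lexx.
  rewrite big_split/= sumr_const -(mulr_natl t) lerD//; first by rewrite ler_wpM2r.
  rewrite [leRHS](bigID (mem S))/= lerDl; apply: sumr_ge0 => i _.
  by rewrite /mxi le_max lexx orbT.
have tot : \sum_i `|tnth g i| `^ p =
    \sum_(i in S) `|tnth g i| `^ p + \sum_(i in ~: S) `|tnth g i| `^ p.
  rewrite (bigID (mem S))/=; congr (_ + _); apply: eq_bigl => i; by rewrite finset.in_setC.
have -> : \sum_i sep p rho t eps (tnth g i) = 2 * (rho * n%:R * t) + 2 * (\sum_i mxi i) -
    \sum_i `|tnth g i| `^ p + \sum_i eps * (1 + tnth g i ^+ 2).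
  rewrite /sep !big_split/= sumrN; congr (_ + _ - _ + _); last by rewrite mulr_sumr.
  by rewrite sumr_const card_ord -[LHS]mulr_natr; ring.
rewrite tot; lra.
Qed.

(** Off the support [v] equals [d]; on it, [|x|^p <= |v|^p + |d|^p]. *)
Lemma null_space_property p n (x v : 'I_n -> R) : 0 < p -> p <= 1 ->
  let d := fun i => v i - x i in
  \sum_(i in supp x) `|d i| `^ p < \sum_(i in ~: supp x) `|d i| `^ p -> lpp p x < lpp p v.
Proof.
move=> p0 p1 d dS; rewrite /lpp.
rewrite (bigID (mem (supp x)))/= [ltRHS](bigID (mem (supp x)))/=.
have -> : \sum_(i | i \notin supp x) `|x i| `^ p = 0.
  by apply: big1 => i; rewrite inE negbK => /eqP ->; rewrite normr0 powR0// gt_eqF.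
have -> : \sum_(i | i \notin supp x) `|v i| `^ p = \sum_(i in ~: supp x) `|d i| `^ p.
  apply: eq_big => i; first by rewrite finset.in_setC.
  by rewrite inE negbK => /eqP xi; rewrite /d xi subr0.
have : \sum_(i in supp x) `|x i| `^ p <=
    \sum_(i in supp x) `|v i| `^ p + \sum_(i in supp x) `|d i| `^ p.
  by rewrite -big_split/=; apply: ler_sum => i _; rewrite /d distrC; exact: powR_normB_le.
lra.
Qed.

End lp_cones.

(** * The threshold *)

Section threshold.
Variable R : realType.
Local Notation leb := (@lebesgue_measure R).

(** Finiteness is not assumed: [fine] sends both infinities to 0. *)
Lemma fineZ (r : R) (x : \bar R) : fine (r%:E * x) = r * fine x.
Proof.
case: x => [s||] //=; rewrite mulr0.
  by rewrite mulry; case: (sgrP r) => _; rewrite ?mul0e ?mul1e ?mulN1e.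
by rewrite mulrNy; case: (sgrP r) => _; rewrite ?mul0e ?mul1e ?mulN1e.
Qed.

(** [halfgauss] is the density of the absolute value of a standard normal variable on the
    half-line. *)
Lemma halfgaussE (x : R) : halfgauss x = 2 * normal_pdf 0 1 x.
Proof.
rewrite normal_pdf01 mulrA /halfgauss; congr (_ * _).
rewrite /normal_peak expr1n mul1r -[pi *+ 2]mulr_natl (sqrtrM pi)// (sqrtrM pi^-1)// sqrtrV ?pi_ge0// invfM mulrA.
congr (_ / _); apply: (mulIf (x := Num.sqrt 2)); first by rewrite sqrtr_eq0 -ltNge.
by rewrite divfK ?sqrtr_eq0 -?ltNge// -expr2 sqr_sqrtr.
Qed.

Lemma measurable_halfgauss : measurable_fun [set: R] (@halfgauss R).
Proof.
rewrite (_ : @halfgauss R = fun x => 2 * normal_pdf 0 1 x); last by apply/funext => x; exact: halfgaussE.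
by apply: measurable_funM => //; exact: measurable_normal_pdf.
Qed.

Lemma integral_gauss1_norm (f : R -> R) : measurable_fun [set: R] f -> (forall x, 0 <= f x) ->
  (\int[gauss1 R]_x (f `|x|)%:E = \int[leb]_(x in `[0%R, +oo[) (f x * halfgauss x)%:E)%E.
Proof.
move=> mf f0.
have mfn : measurable_fun [set: R] (fun x => f `|x|) by exact: (measurableT_comp mf).
rewrite integral_gauss1; [|exact/measurable_EFinP|by move=> x; rewrite lee_fin].
pose F (x : R) : \bar R := ((f `|x|) * normal_pdf 0 1 x)%:E.
have mF : measurable_fun [set: R] F.
  by apply/measurable_EFinP; apply: measurable_funM => //; exact: measurable_normal_pdf.
have F0 x : (0 <= F x)%E by rewrite lee_fin mulr_ge0// normal_pdf_ge0.
have FN x : F (- x) = F x by rewrite /F normrN !normal_pdf01 sqrrN.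
transitivity (\int[leb]_(x in [set: R]) F x)%E; first by apply: eq_integral => x _; rewrite -EFinM.
transitivity (2%:E * \int[leb]_(x in `[0%R, +oo[) F x)%E; last first.
  rewrite -ge0_integralZl_EFin//; last by apply: measurable_funTS.
  apply: eq_integral => x; rewrite inE/= in_itv/= andbT => x0.
  by rewrite -EFinM halfgaussE (ger0_norm x0) mulrCA.
have -> : [set: R] = `]-oo, 0%R[%classic `|` `[0%R, +oo[%classic.
  by apply/seteqP; split => x //= _; rewrite !in_itv/= andbT; case: (ltP x 0); [left|right].
rewrite ge0_integral_setU//=; last 2 first.
  - exact: measurable_funTS.
  - apply/disj_setPS => x /=; rewrite !in_itv/= andbT => -[x0 x1].
    by move: (lt_le_trans x0 x1); rewrite ltxx.
rewrite mule_natl mule2n; congr (_ + _)%E.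
rewrite integral_itv_bndo_bndc; last exact: measurable_funTS.
by rewrite (ge0_integration_by_substitution0 mF F0); apply: eq_integral => x _; rewrite FN.
Qed.

(** The substitution of [x / sqrt 2] for the variable; the value is the probability that a standard
    normal variable is at most [z] in absolute value. *)
Lemma erfE (z : R) : 0 < z ->
  erf (z / Num.sqrt 2) = fine (\int[leb]_(x in `[0%R, z]) (halfgauss x)%:E)%E.
Proof.
move=> z0; rewrite /erf /Rintegral.
have s0 : 0 < Num.sqrt 2 :> R by rewrite sqrtr_gt0.
have s2 : (Num.sqrt 2) ^+ 2 = 2 :> R by rewrite sqr_sqrtr.
(* The boolean factor extends the integrand to the whole line, where [integral_affine] applies. *)
pose f (t : R) : R := (0 <= t <= z / Num.sqrt 2)%R%:R * expR (- t ^+ 2).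
have me (g : R -> R) : measurable_fun [set: R] g -> measurable_fun [set: R] (fun t : R => expR (- g t)).
  by move=> mg; apply: measurableT_comp => //; exact: measurableT_comp.
have mb (u : R) : measurable_fun [set: R] (fun t : R => (0 <= t <= u)%R%:R : R).
  by apply: measurable_bool_natr; apply: measurable_and; exact: measurable_fun_ler.
have mf : measurable_fun [set: R] (EFin \o f).
  apply/measurable_EFinP; apply: measurable_funM; first exact: mb.
  apply: me; exact: measurable_funX.
have itvE (u : R) (g : R -> R) :
    (\int[leb]_(x in `[0%R, u]) (g x)%:E = \int[leb]_x ((0 <= x <= u)%R%:R * g x)%:E)%E.
  rewrite integral_mkcond; apply: eq_integral => x _.
  by rewrite patchE mem_setE in_itv/=; case: ifP; rewrite ?mul1r ?mul0r.
have LE : (\int[leb]_(x in `[0%R, (z / Num.sqrt 2)%R]) (expR (- x ^+ 2))%:E = \int[leb]_x (EFin \o f) x)%E.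
  exact: itvE.
rewrite LE (@integral_affine R (Num.sqrt 2)^-1 0 (EFin \o f)); last 3 first.
  - by rewrite invr_eq0 gt_eqF.
  - exact: mf.
  - by move=> x; rewrite lee_fin mulr_ge0// expR_ge0.
rewrite itvE fineZ gtr0_norm ?invr_gt0//.
rewrite (_ : \int[leb]_x ((0 <= x <= z)%R%:R * halfgauss x)%:E =
    (Num.sqrt (2 / pi))%:E * \int[leb]_x (EFin \o f) ((Num.sqrt 2)^-1 * x + 0)%R)%E.
  rewrite fineZ mulrA; congr (_ * _); rewrite sqrtrM// sqrtrV ?pi_ge0// mulrAC; congr (_ / _).
  by apply: (mulIf (lt0r_neq0 s0)); rewrite divfK ?gt_eqF// -expr2 s2.
have f0 (x : R) : setT x -> (0 <= (EFin \o f) ((Num.sqrt 2)^-1 * x + 0)%R)%E.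
  by move=> _; rewrite lee_fin mulr_ge0// expR_ge0.
have mfa : measurable_fun [set: R] (fun x => (EFin \o f) ((Num.sqrt 2)^-1 * x + 0)%R).
  apply: (measurableT_comp mf); apply: measurable_funD => //; exact: measurable_funM.
apply: esym; apply: (etrans (esym (ge0_integralZl_EFin leb measurableT f0 mfa (sqrtr_ge0 _)))).
apply: eq_integral => x _; apply: esym; rewrite /= -EFinM addr0 /f /halfgauss mulrCA.
have -> : (0 <= (Num.sqrt 2)^-1 * x <= z / Num.sqrt 2) = (0 <= x <= z).
  by rewrite mulrC ler_pM2r ?invr_gt0// pmulr_lge0 ?invr_gt0.
by rewrite exprMn exprVn s2 [_^-1 * _]mulrC mulNr.
Qed.

Lemma powR_lt_threshold (p z x : R) : 0 < p -> 0 < z -> 0 <= x ->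
  Num.max (x `^ p - z `^ p) 0 = (z <= x)%R%:R * (x `^ p - z `^ p).
Proof.
move=> p0 z0 x0; case: (leP z x) => zx.
  rewrite mul1r; apply/max_idPl; rewrite subr_ge0.
  by apply: ge0_ler_powR; rewrite ?nnegrE ?(ltW p0) ?(ltW z0).
rewrite mul0r; apply/max_idPr; rewrite subr_le0.
by apply: ge0_ler_powR; rewrite ?nnegrE ?(ltW p0) ?(ltW z0) ?(ltW zx).
Qed.

(** Without slack, [sep] is [a - b - 2 t (1 - rho - e)] at [|x|], where [a] and [b] are the parts of
    the power above and below [zs] and [e] indicates values below [zs]. The means of [a] and [b]
    cancel, and what remains is [-2 t (1 - J - rho) < 0]. *)
Lemma exists_sep_neg (p rho zs : R) : 0 < p -> p <= 1 -> is_zstar p zs -> rho < rhostar_of zs ->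
  exists2 eps, 0 < eps & \int[gauss1 R]_x sep p rho (zs `^ p) eps x < 0.
Proof.
move=> p0 p1 [z0 zE]; rewrite /rhostar_of erfE// => rhoz.
set t := zs `^ p; have t0 : 0 < t by exact: powR_gt0.
have mge : measurable_fun [set: R] (fun x : R => (zs <= x)%R%:R : R).
  by apply: measurable_bool_natr; exact: measurable_fun_ler.
have mlt : measurable_fun [set: R] (fun x : R => (x < zs)%R%:R : R).
  by apply: measurable_bool_natr; exact: measurable_fun_ltr.
have mp : measurable_fun [set: R] (fun x : R => x `^ p) by exact: measurable_powR.
pose a (x : R) := (zs <= x)%R%:R * x `^ p.
pose b (x : R) := (x < zs)%R%:R * x `^ p.
pose e (x : R) : R := (x < zs)%R%:R.
have ma : measurable_fun [set: R] a by exact: measurable_funM.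
have mb : measurable_fun [set: R] b by exact: measurable_funM.
have a0 x : 0 <= a x by rewrite mulr_ge0// powR_ge0.
have b0 x : 0 <= b x by rewrite mulr_ge0// powR_ge0.
have e0 x : 0 <= e x by [].
have mhg (g : R -> R) : measurable_fun [set: R] g -> measurable_fun [set: R] (fun x => (g x * halfgauss x)%:E).
  by move=> mg; apply/measurable_EFinP; apply: measurable_funM => //; exact: measurable_halfgauss.
have lowE (g : R -> R) : measurable_fun [set: R] g ->
    (\int[leb]_(x in `[0%R, +oo[) ((x < zs)%R%:R * g x * halfgauss x)%:E =
     \int[leb]_(x in `[0%R, zs]) (g x * halfgauss x)%:E)%E.
  move=> mg; rewrite -integral_itv_bndo_bndc; last by apply: measurable_funTS; exact: mhg.
  rewrite integral_mkcond [RHS]integral_mkcond; apply: eq_integral => x _.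
  rewrite !patchE !mem_setE !in_itv/= andbT; case: (0 <= x) => //=.
  by case: (x < zs); rewrite ?mul1r ?mul0r.
have highE : (\int[leb]_(x in `[0%R, +oo[) (a x * halfgauss x)%:E =
     \int[leb]_(x in `[zs, +oo[) (x `^ p * halfgauss x)%:E)%E.
  rewrite integral_mkcond [RHS]integral_mkcond; apply: eq_integral => x _.
  rewrite !patchE !mem_setE !in_itv/= !andbT /a; case: (leP zs x) => zx.
    by rewrite (le_trans (ltW z0) zx) mul1r.
  by case: ifP => // _; rewrite !mul0r.
have mn (g : R -> R) : measurable_fun [set: R] g -> measurable_fun [set: R] (fun x => g `|x|).
  by move=> mg; exact: (measurableT_comp mg).
have int_pow (g : R -> R) : measurable_fun [set: R] g -> (forall x, 0 <= g x) ->
    (forall x, g x <= `|x| `^ p + 1) -> (gauss1 R).-integrable setT (EFin \o (fun x => g `|x|)).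
  move=> mg g0 gp; apply: (@gauss_integrable _ _ 8); first exact: mn.
  move=> x; rewrite ger0_norm//; apply: le_trans (gp _) _; rewrite normr_id.
  have := powR_norm_le x p0 p1; have := gexp_ge x; have := sqr_ge0 x; lra.
have Ia : (gauss1 R).-integrable setT (EFin \o (fun x => a `|x|)).
  apply: int_pow => // x; rewrite /a; case: (leP zs x) => zx; last by rewrite mul0r addr_ge0// powR_ge0.
  by rewrite mul1r (ger0_norm (le_trans (ltW z0) zx)) lerDl.
have Ib : (gauss1 R).-integrable setT (EFin \o (fun x => Num.max 0 (b `|x|))).
  apply: (@gauss_integrable _ _ 8).
    by apply: measurable_maxr => //; exact: mn.
  move=> x; rewrite ger0_norm; last by rewrite le_max lexx.
  rewrite /b; have := powR_norm_le x p0 p1; have := gexp_ge x; have := sqr_ge0 x.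
  have := powR_ge0 `|x| p => ? ? ? ?; rewrite ge_max; apply/andP; split; first by lra.
  by case: (_ < _); rewrite ?mul1r ?mul0r; lra.
have {}Ib : (gauss1 R).-integrable setT (EFin \o (fun x => b `|x|)).
  apply: eq_integrable Ib => // x _ /=; congr EFin; exact/max_idPr.
have Ie : (gauss1 R).-integrable setT (EFin \o (fun x => e `|x|)).
  apply: int_pow => // x; rewrite /e; apply: (@le_trans _ _ 1); first by case: (_ < _).
  by rewrite lerDr powR_ge0.
have Ec c : (gauss1 R).-integrable setT (EFin \o cst (c : R)).
  apply: (@gauss_integrable _ _ (4 * `|c|)) => // x; rewrite /=.
  have := gexp_ge x; have := sqr_ge0 x; have := normr_ge0 c; nra.
have Iq : (gauss1 R).-integrable setT (EFin \o (fun x => 1 + x ^+ 2)).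
  apply: (@gauss_integrable _ _ 4); first by apply: measurable_funD => //; exact: measurable_funX.
  by move=> x; rewrite ger0_norm ?addr_ge0 ?sqr_ge0// gexp_ge.
(* The equation that defines [zs]. *)
have RA : \int[gauss1 R]_x a `|x| = \int[gauss1 R]_x b `|x|.
  rewrite /Rintegral (integral_gauss1_norm ma a0) (integral_gauss1_norm mb b0).
  by rewrite highE (lowE _ mp) zE.
have RE : \int[gauss1 R]_x e `|x| = fine (\int[leb]_(x in `[0%R, zs]) (halfgauss x)%:E)%E.
  rewrite /Rintegral (integral_gauss1_norm mlt e0); congr fine.
  transitivity (\int[leb]_(x in `[0%R, +oo[) ((x < zs)%R%:R * cst 1 x * halfgauss x)%:E)%E.
    by apply: eq_integral => x _; rewrite /= mulr1.
  rewrite lowE//; apply: eq_integral => x _; by rewrite /= mul1r.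
set J := fine _ in RE rhoz; set M := \int[gauss1 R]_x (1 + x ^+ 2).
have M0 : 0 <= M by apply: Rintegral_ge0 => x _; rewrite addr_ge0// sqr_ge0.
(* The slack then has mean [eps * M], less than half of the gap [2 t (1 - J - rho)]. *)
pose eps := t * (1 - J - rho) / (M + 1).
have eps0 : 0 < eps.
  by rewrite divr_gt0 ?ltr_wpDl// mulr_gt0// subr_gt0.
exists eps => //.
have sepE x : sep p rho t eps x =
    ((2 * rho * t - 2 * t) + a `|x| + 2 * t * e `|x| - b `|x|) + eps * (1 + x ^+ 2).
  rewrite /sep /t powR_lt_threshold// /a /b /e; congr (_ + _).
  by case: (leP zs `|x|) => _ /=; rewrite ?mul1r ?mul0r ?mulr1 ?mulr0; ring.
have I1 := integrableD measurableT (Ec (2 * rho * t - 2 * t)) Ia.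
have I2 := integrableZl measurableT (2 * t) Ie.
have I3 := integrableD measurableT I1 I2.
have I4 := integrableB measurableT I3 Ib.
have I5 := integrableZl measurableT eps Iq.
under eq_Rintegral do rewrite sepE.
rewrite (RintegralD _ I4 I5)// (RintegralB _ I3 Ib)// (RintegralD _ I1 I2)// (RintegralD _ (Ec _) Ia)//.
rewrite !RintegralZl// Rintegral_gauss1_cst RE RA -/M.
have h2 : 0 < t * (1 - J - rho) by rewrite mulr_gt0// subr_gt0.
have h : eps * M < t * (1 - J - rho).
  by rewrite /eps mulrAC ltr_pdivrMr ?ltr_wpDl// ltr_pM2l// ltrDl.
lra.
Qed.

End threshold.

(** * The law of a matrix of independent Gaussian entries *)

Section transfer.
Variable R : realType.
Context d (Omega : measurableType d) (P : probability Omega R).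

Definition gmx m n (A : 'I_m -> 'I_n -> Omega -> R) (w : Omega) : m.-tuple (n.-tuple R) :=
  [tuple [tuple A i j w | j < n] | i < m].

Lemma measurable_gmx m n (A : 'I_m -> 'I_n -> Omega -> R) :
  (forall i j, measurable_fun [set: Omega] (A i j)) -> measurable_fun [set: Omega] (gmx A).
Proof.
move=> mA; apply/measurable_fun_tnthP => i.
rewrite (_ : _ \o _ = fun w => [tuple A i j w | j < n]); first exact: measurable_mktuple.
by apply/funext => w /=; rewrite tnth_mktuple.
Qed.

(** Both laws are compared on boxes whose sides are boxes of reals; there independence gives the
    double product over entries. *)
Lemma gaussmx_law m n (A : 'I_m -> 'I_n -> Omega -> R) :
  (forall i j, std_gaussian_rv P (A i j)) ->
  mutually_independent P (fun ij : 'I_m * 'I_n => A ij.1 ij.2) ->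
  forall S, measurable S -> P (gmx A @^-1` S) = gaussmx R m n S.
Proof.
move=> gA iA S mS.
have mA i j : measurable_fun [set: Omega] (A i j) by have [] := gA i j.
have mg := measurable_gmx mA.
pose g : {mfun Omega >-> m.-tuple (n.-tuple R)} := HB.pack (gmx A) (isMeasurableFun.Build _ _ _ _ _ mg).
have mE : (@measurable _ R) = <<s @measurable _ R >>.
  exact/esym/sigma_algebra_id/sigma_algebra_measurable.
pose G : set (set (n.-tuple R)) :=
  [set C | exists2 B : 'I_n -> set R, (forall i, measurable (B i)) & C = box B].
transitivity (distribution P g S) => //.
apply: (pow_unique (G := G)) => //.
- exact: measurable_tuple_generated.
- by apply: setI_closed_box; exact: measurableI.
- by exists (fun=> setT) => //; apply/seteqP; split.
move=> B GB.
pose C i := projT1 (cid2 (GB i)).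
have mC i j : measurable (C i j) by rewrite /C; case: cid2.
have BE i : B i = box (C i) by rewrite /C; case: cid2.
rewrite -[LHS]/(P (gmx A @^-1` box B)) [X in P X](_ : _ =
    \bigcap_(ij in [set: 'I_m * 'I_n]) (A ij.1 ij.2 @^-1` C ij.1 ij.2)); last first.
  apply/seteqP; split => w /=.
    move=> h [i j] _ /=; have := h i; rewrite BE tnth_mktuple => /(_ j).
    by rewrite tnth_mktuple.
  move=> h i; rewrite BE tnth_mktuple => j; rewrite tnth_mktuple.
  exact: (h (i, j) I).
rewrite iA; last by move=> [i j].
under eq_bigr => ij _ do rewrite (proj2 (gA ij.1 ij.2) _ (mC ij.1 ij.2)).
rewrite (eq_bigl xpredT); last by move=> ij; exact: mem_set.
rewrite -(pair_big xpredT xpredT (fun i j => normal_prob 0 1 (C i j)))/=.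
by apply: eq_bigr => i _; rewrite BE /gauss pow_box.
Qed.

(** Discarded rows are tested against [setT], which contributes factors 1 to the product. *)
Lemma mutually_independent_rows m0 m n (hm : (m0 <= m)%N) (A : 'I_m -> 'I_n -> Omega -> R) :
  (forall i j, measurable_fun [set: Omega] (A i j)) ->
  mutually_independent P (fun ij : 'I_m * 'I_n => A ij.1 ij.2) ->
  mutually_independent P (fun ij : 'I_m0 * 'I_n => A (widen_ord hm ij.1) ij.2).
Proof.
move=> mA iA B mB.
pose B' (ij : 'I_m * 'I_n) : set R :=
  if insub (val ij.1) is Some i0 then B (i0, ij.2) else setT.
have B'E i j : B' (widen_ord hm i, j) = B (i, j).
  by rewrite /B' /= valK.
have mB' ij : measurable (B' ij) by rewrite /B'; case: insub => [i0|].
have := iA B' mB'.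
have -> : \bigcap_(ij in [set: 'I_m * 'I_n]) (A ij.1 ij.2 @^-1` B' ij) =
   \bigcap_(ij in [set: 'I_m0 * 'I_n]) (A (widen_ord hm ij.1) ij.2 @^-1` B ij).
  apply/seteqP; split => w h [i j] _ /=.
    by have := h (widen_ord hm i, j) I; rewrite /= B'E.
  rewrite /B' /=; case: insubP => [i0 im e|//].
  have := h (i0, j) I; rewrite /= (_ : widen_ord hm i0 = i)//.
  exact/val_inj.
move=> ->.
rewrite (eq_bigl xpredT); last by move=> ij; exact: mem_set.
rewrite [RHS](eq_bigl xpredT); last by move=> ij; exact: mem_set.
rewrite -(pair_bigA _ (fun i j => P (A i j @^-1` B' (i, j)))).
rewrite [RHS](eq_bigr (fun ij => P (A (widen_ord hm ij.1) ij.2 @^-1` B (ij.1, ij.2)))); last by move=> [].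
rewrite -(pair_bigA _ (fun i j => P (A (widen_ord hm i) j @^-1` B (i, j)))).
rewrite (bigID (fun i : 'I_m => i < m0)%N)/= [X in (_ * X)%E]big1 ?mule1; last first.
  move=> i im; apply: big1 => j _; rewrite /B' /= insubF; last exact: negbTE.
  by rewrite preimage_setT probability_setT.
rewrite big_ord_narrow; apply: eq_bigr => i _; apply: eq_bigr => j _.
by rewrite B'E.
Qed.

End transfer.

(** * Choice of the constants *)

(* Only the first [m0] rows of [A] will be used; this leaves a kernel of dimension [k > 0] even
   when [m >= n]. *)
Lemma row_budget (R : realType) (L : R) (C : nat) : 0 < L -> exists theta : R,
  [/\ 0 < theta, theta < 1 &
    exists N : nat, forall m n : nat, (N <= n)%N -> 1 - theta < m%:R / n%:R ->
      exists m0 k : nat, [/\ (m0 <= m)%N, (m0 + k = n)%N, (0 < k)%N, (0 < n)%N &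
        (C ^ k)%:R * expR (- L * n%:R) <= expR (- (L / 2) * n%:R)]].
Proof.
move=> L0; pose c : R := ln (C.+2)%:R.
have C1 : 1 < (C.+2)%:R :> R by rewrite ltr1n.
have c0 : 0 < c by exact: ln_gt0.
(* The second bound gives [c * k <= 2 c theta n <= L n / 4], well within the half of the rate that
   may be spent. *)
pose theta : R := Num.min (1 / 4) (L / (8 * c)).
have th0 : 0 < theta by rewrite lt_min !divr_gt0// mulr_gt0.
have th1 : theta <= 1 / 4 by rewrite ge_min lexx.
have thc : theta * c <= L / 8.
  have : theta <= L / (8 * c) by rewrite ge_min lexx orbT.
  by rewrite ler_pdivlMr ?mulr_gt0// => h; lra.
exists theta; split=> //; first by lra.
(* From this rank on [theta * n >= 1], which absorbs the rounding of [m0] and gives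
   [k <= 2 theta n]. *)
exists (Num.trunc (theta^-1)).+1 => m n Nn mn.
have n0 : (0 < n)%N by exact: leq_trans Nn.
have nR : 0 < n%:R :> R by rewrite ltr0n.
have thn : 1 <= theta * n%:R.
  rewrite mulrC -ler_pdivrMr// mul1r ltW// (lt_le_trans (truncnS_gt _))// ler_nat//.
have cn0 : 0 <= (1 - theta) * n%:R by rewrite mulr_ge0//; lra.
have /andP[m01 m02] := truncn_itv cn0.
set m0 := Num.trunc _ in m01 m02.
have m0n : (m0 < n)%N.
  by rewrite -(ltr_nat R); apply: le_lt_trans m01 _; rewrite gtr_pMl//; lra.
have m0m : (m0 <= m)%N.
  rewrite -(ler_nat R); apply: le_trans m01 _; rewrite -ler_pdivlMr//; exact: ltW.
exists m0, (n - m0)%N; split=> //; first by rewrite subnKC// ltnW.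
  by rewrite subn_gt0.
have kb : (n - m0)%:R <= 2 * (theta * n%:R) :> R.
  rewrite natrB ?(ltnW m0n)//; move: m02; rewrite -natr1; lra.
apply: (@le_trans _ _ (expR (c * (n - m0)%:R) * expR (- L * n%:R))).
  have -> : expR (c * (n - m0)%:R) = (C.+2)%:R ^+ (n - m0).
    by rewrite mulrC expRM_natl /c lnK// posrE (lt_trans ltr01).
  by rewrite ler_wpM2r ?expR_ge0// natrX lerXn2r ?nnegrE ?ler0n// ler_nat ltnW.
rewrite -expRD ler_expR.
have h1 : c * (n - m0)%:R <= c * (2 * (theta * n%:R)) by rewrite ler_pM2l.
have h2 : (theta * c) * n%:R <= L / 8 * n%:R by rewrite ler_pM2r.
have h3 : 0 < L * n%:R by rewrite mulr_gt0.
nra.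
Qed.

Theorem theorem5 (R : realType) (p rho zs : R) :
  0 < p -> p <= 1 -> is_zstar p zs -> rho < rhostar_of zs ->
  exists c4 c5 : R, [/\ 0 < c4, c4 < 1, 0 < c5 &
    exists N : nat, forall m n : nat, (N <= n)%N -> c4 < m%:R / n%:R ->
      forall (d : measure_display) (Omega : measurableType d) (P : probability Omega R)
             (A : 'I_m -> 'I_n -> Omega -> R),
        (forall i j, std_gaussian_rv P (A i j)) ->
        mutually_independent P (fun ij : 'I_m * 'I_n => A ij.1 ij.2) ->
        exists E : set Omega, [/\ measurable E,
          (P E >= (1 - expR (- c5 * n%:R))%:E)%E &
          forall w, E w -> forall x : 'I_n -> R,
            (#|supp x|%:R <= rho * n%:R) ->
            unique_lp_min p (fun i j => A i j w) x]].
Proof.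
move=> p0 p1 zP rhoz.
have [eps eps0 sepneg] := exists_sep_neg p0 p1 zP rhoz.
set t := zs `^ p in sepneg; have t0 : 0 <= t by exact: powR_ge0.
have [eta eta0 coneP] := cone_sep rho p0 p1 t0 eps0.
have [K K0 sepK] := sep_le rho p0 p1 t0 (ltW eps0).
have [l [r [l0 r0 r1 lap]]] := gauss_laplace (measurable_sep p rho t eps) K0 sepK sepneg.
have [C coneC] := gaussmx_kernel_cones eta0.
pose L := - ln r.
have L0 : 0 < L by rewrite oppr_gt0 ln_lt0// r0.
have rE n : r ^+ n = expR (- L * n%:R) by rewrite opprK mulrC expRM_natl lnK.
have [theta [th0 th1 [N NP]]] := row_budget C L0.
(* Half of the Chernoff rate [L] pays for the factor [C ^ k], the other half is [c5]. *)
exists (1 - theta), (L / 2); split; rewrite ?subr_gt0 ?divr_gt0//; first by rewrite ltrBlDr ltrDl.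
exists N => m n Nn mn d Omega P A gA iA.
have [m0 [k [m0m m0k k0 n0 budget]]] := NP m n Nn mn.
have mA i j : measurable_fun [set: Omega] (A i j) by have [] := gA i j.
(* A vector killed by [A] is killed by its first rows, so excluding violations in the larger kernel
   of [A0] suffices. *)
pose A0 (i : 'I_m0) := A (widen_ord m0m i).
have iA0 := mutually_independent_rows m0m mA iA.
have lawE := gaussmx_law (fun i j => gA (widen_ord m0m i) j) iA0.
pose Bad (g : n.-tuple R) := 0 <= \sum_(i < n) sep p rho t eps (tnth g i).
have mBad : measurable_fun [set: n.-tuple R] Bad.
  apply: measurable_fun_ler => //; apply: measurable_sum => i.
  exact: (measurableT_comp (measurable_sep p rho t eps) (measurable_tnth i)).
have [E [mE PE] EP] := coneC m0 k n m0k k0 Bad mBad.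
have mgA : measurable_fun [set: Omega] (gmx A0) by apply: measurable_gmx => i j; exact: mA.
exists (gmx A0 @^-1` E); split.
- by rewrite -[X in measurable X]setTI; exact: mgA.
- rewrite lawE//.
  have PC : gaussmx R m0 n E = (1 - gaussmx R m0 n (~` E))%E.
    by rewrite -[in LHS](setCK E) probability_setC//; exact: measurableC.
  rewrite PC EFinB leeB//; apply: le_trans PE _.
  apply: (@le_trans _ _ ((C ^ k)%:R%:E * (r ^+ n)%:E)%E).
    apply: lee_wpmul2l; first by rewrite lee_fin.
    exact: (gauss_sum_ge0 n (measurable_sep p rho t eps) (ltW l0) lap).
  by rewrite -EFinM lee_fin rE.
move=> w Ew x xsupp v Avx vx; apply: null_space_property => //.
rewrite ltNge; apply/negP => bad.
pose u : 'cV[R]_n := \col_i (v i - x i).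
have u0 : u != 0.
  apply/eqP => u0; apply: vx; apply/funext => i; apply/eqP; rewrite -subr_eq0.
  by have := congr1 (fun z : 'cV[R]_n => z i 0) u0; rewrite !mxE => ->.
have Au : mx (gmx A0 w) *m u = 0.
  apply/colP => i; rewrite !mxE.
  have /(congr1 (fun f => f (widen_ord m0m i))) := Avx; rewrite /matvec => /eqP.
  rewrite -subr_eq0 -sumrB => /eqP e; rewrite -[RHS]e; apply: eq_bigr => j _.
  by rewrite !mxE !tnth_mktuple mulrBr.
(* The violating direction has a vector outside [Bad] in its cone, whereas [coneP] puts every vector
   of that cone in [Bad]. *)
have [|g gu] := EP _ Ew ((enorm u)^-1 *: u) _ (enorm_unit u0).
  by rewrite -scalemxAr Au scaler0.
move/negP; apply; apply: (coneP n _ (supp x) g xsupp _ gu).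
have uE i : `|((enorm u)^-1 *: u) i 0| `^ p = (enorm u)^-1 `^ p * `|v i - x i| `^ p.
  by rewrite !mxE normrM powRM ?normr_ge0// ger0_norm// invr_ge0 enorm_ge0.
under eq_bigr do rewrite uE; under [leRHS]eq_bigr do rewrite uE.
by rewrite -!mulr_sumr ler_wpM2l// powR_ge0.
Qed.
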